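(* The elements $\mathrm{Str}\,\widehat{E}^k$, $k\ge1$, generate (as an algebra) the center $\mathcal{Z}(\mathfrak{gl}_{m|n})$ of the universal enveloping algebra $\mathrm{U}(\mathfrak{gl}_{m|n})$.
   Context: Everything is over $\mathbb{C}$. $V=\mathbb{C}^{m|n}$ has homogeneous basis $e_1,\dots,e_{m+n}$ with parity $|i|=\bar0$ iff $i\le m$; $e_{ij}$ are the matrix units of $\mathrm{End}(V)$ and $E_{ij}$ the corresponding basis elements of $\mathfrak{gl}_{m|n}$, of parity $|i|+|j|$, with $[E_{ij},E_{kl}]=\delta_{jk}E_{il}-(-1)^{(|i|+|j|)(|k|+|l|)}\delta_{li}E_{kj}$. Put $$\widehat{E}=\sum_{i,j=1}^{m+n}(-1)^{|i||j|+|i|+|j|}e_{ij}\otimes E_{ij}\in\mathrm{End}(V)\otimes\mathrm{U}(\mathfrak{gl}_{m|n}),$$ where the tensor product superalgebra has multiplication $(a_1\otimes b_1)(a_2\otimes b_2)=(-1)^{|a_2||b_1|}a_1a_2\otimes b_1b_2$. $\mathrm{Str}\colon\mathrm{End}(V)\otimes\mathrm{U}(\mathfrak{gl}_{m|n})\to\mathrm{U}(\mathfrak{gl}_{m|n})$ is the supertrace $e_{ij}\mapsto(-1)^{|i|}\delta_{ij}$ applied to the first factor. Explicitly, $\mathrm{Str}\,\widehat{E}^k=\sum_{i_1,\dots,i_k}(-1)^{|i_1|+\cdots+|i_{k-1}|}E_{i_ki_1}E_{i_1i_2}\cdots E_{i_{k-1}i_k}$. $\mathcal{Z}(\mathfrak{g})=\mathrm{U}(\mathfrak{g})^{\mathfrak{g}}$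 is the (super)center. *)

(* Defs.v *)
From HB Require Import structures.
From mathcomp Require Import all_boot all_order all_algebra.
From mathcomp Require Import boolp classical_sets reals complex.
From mathcomp Require Import lra ring.

Set Implicit Arguments.
Unset Strict Implicit.
Unset Printing Implicit Defensive.

Import GRing.Theory Num.Theory.
Local Open Scope ring_scope.

(* Parities are booleans, with [true] the odd parity. *)

(* Lie superalgebras over a field of characteristic 0.  The Z/2-grading is
   given by the projections [hcomp p] onto the homogeneous components, so that
   [x] is homogeneous of parity [p] iff [hcomp p x = x]. *)
HB.mixin Record Lmodule_isLieSuper (F : numFieldType) g
    of GRing.Lmodule F g := {
  hcomp : bool -> g -> g;
  hcomp_linear : forall p, linear (hcomp p);
  hcompK : forall p q x, hcomp p (hcomp q x) = if p == q then hcomp p x else 0;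
  hcompD : forall x, hcomp false x + hcomp true x = x;
  sbr : g -> g -> g;
  sbr_linearl : forall y, linear (sbr ^~ y);
  sbr_linearr : forall x, linear (sbr x);
  sbr_hom : forall p q x y, hcomp p x = x -> hcomp q y = y ->
    hcomp (p (+) q) (sbr x y) = sbr x y;
  sbr_skew : forall p q x y, hcomp p x = x -> hcomp q y = y ->
    sbr x y = - ((-1) ^+ (p && q) *: sbr y x);
  sbr_jacobi : forall p q x y z, hcomp p x = x -> hcomp q y = y ->
    sbr x (sbr y z) = sbr (sbr x y) z + (-1) ^+ (p && q) *: sbr y (sbr x z)
}.

#[short(type="lieSuperType")]
HB.structure Definition LieSuper (F : numFieldType) :=
  {g of Lmodule_isLieSuper F g & GRing.Lmodule F g}.

Arguments sbr_hom {F s} [p q x y].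
Arguments sbr_skew {F s} [p q x y].
Arguments sbr_jacobi {F s} [p q x y].

HB.instance Definition _ (F : numFieldType) (g : lieSuperType F) (p : bool) :=
  GRing.isLinear.Build F g g *:%R (@hcomp F g p) (hcomp_linear p).

(* The universal enveloping algebra of [g]: the unital associative algebra
   generated by the vector space [g] subject to
   x y - (-1)^{|x||y|} y x = [x, y] for homogeneous x and y.
   It is constructed as formal expressions modulo the congruence [env_rel]
   generated by the algebra axioms, the linearity of g -> U(g) and these
   relations.  Its universal property is given by [env_lift_linear],
   [env_lift_monoid], [env_liftE] and [env_lift_unique]. *)
Section Envelope.
Variables (F : numFieldType) (g : lieSuperType F).

Inductive env_pre : Type :=
| PGen of g
| PZero
| POne
| PAdd of env_pre & env_pre
| PScale of F & env_pre
| PMul of env_pre & env_pre.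

Inductive env_rel : env_pre -> env_pre -> Prop :=
| rel_refl u : env_rel u u
| rel_sym u v : env_rel u v -> env_rel v u
| rel_trans u v w : env_rel u v -> env_rel v w -> env_rel u w
| rel_add u u' v v' :
    env_rel u u' -> env_rel v v' -> env_rel (PAdd u v) (PAdd u' v')
| rel_scale a u u' : env_rel u u' -> env_rel (PScale a u) (PScale a u')
| rel_mul u u' v v' :
    env_rel u u' -> env_rel v v' -> env_rel (PMul u v) (PMul u' v')
| rel_addA u v w : env_rel (PAdd u (PAdd v w)) (PAdd (PAdd u v) w)
| rel_addC u v : env_rel (PAdd u v) (PAdd v u)
| rel_add0 u : env_rel (PAdd PZero u) u
| rel_scaleA a b u : env_rel (PScale a (PScale b u)) (PScale (a * b) u)
| rel_scale0 u : env_rel (PScale 0 u) PZero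
| rel_scale1 u : env_rel (PScale 1 u) u
| rel_scaleDr a u v :
    env_rel (PScale a (PAdd u v)) (PAdd (PScale a u) (PScale a v))
| rel_scaleDl a b u :
    env_rel (PScale (a + b) u) (PAdd (PScale a u) (PScale b u))
| rel_mulA u v w : env_rel (PMul u (PMul v w)) (PMul (PMul u v) w)
| rel_mul1l u : env_rel (PMul POne u) u
| rel_mul1r u : env_rel (PMul u POne) u
| rel_mulDl u v w : env_rel (PMul (PAdd u v) w) (PAdd (PMul u w) (PMul v w))
| rel_mulDr u v w : env_rel (PMul u (PAdd v w)) (PAdd (PMul u v) (PMul u w))
| rel_scaleAl a u v : env_rel (PScale a (PMul u v)) (PMul (PScale a u) v)
| rel_scaleAr a u v : env_rel (PScale a (PMul u v)) (PMul u (PScale a v))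
| rel_gen a x y :
    env_rel (PGen (a *: x + y)) (PAdd (PScale a (PGen x)) (PGen y))
| rel_sbr p q x y : hcomp p x = x -> hcomp q y = y ->
    env_rel (PAdd (PMul (PGen x) (PGen y))
                  (PScale (- (-1) ^+ (p && q)) (PMul (PGen y) (PGen x))))
            (PGen (sbr x y)).

HB.instance Definition _ := gen_eqMixin env_pre.
HB.instance Definition _ := gen_choiceMixin env_pre.

Definition env_relb (u v : env_pre) : bool := `[< env_rel u v >].

Lemma env_relb_refl : reflexive env_relb.
Proof. by move=> u; apply/asboolP/rel_refl. Qed.
Lemma env_relb_sym : symmetric env_relb.
Proof. by move=> u v; apply/asboolP/asboolP; apply: rel_sym. Qed.
Lemma env_relb_trans : transitive env_relb.
Proof. by move=> v u w /asboolP uv /asboolP vw; apply/asboolP/(rel_trans uv). Qed.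

Canonical env_equiv :=
  EquivRel env_relb env_relb_refl env_relb_sym env_relb_trans.

Definition env := {eq_quot env_equiv}%qT.
HB.instance Definition _ := Choice.on env.

Definition env_pi (u : env_pre) : env := (\pi_({eq_quot env_equiv}) u)%qT.
Definition env_repr (u : env) : env_pre := repr u.

Lemma env_piP u v : env_pi u = env_pi v <-> env_rel u v.
Proof.
split=> [/eqmodP/asboolP //|uv].
by apply/eqmodP/asboolP.
Qed.

Lemma env_reprK : cancel env_repr env_pi.
Proof. exact: reprK. Qed.

Lemma env_repr_pi u : env_rel (env_repr (env_pi u)) u.
Proof. by apply/env_piP; rewrite env_reprK. Qed.

Definition env_zero := env_pi PZero.
Definition env_one := env_pi POne.
Definition env_add u v := env_pi (PAdd (env_repr u) (env_repr v)).
Definition env_scale a u := env_pi (PScale a (env_repr u)).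
Definition env_mul u v := env_pi (PMul (env_repr u) (env_repr v)).

Lemma env_piD u v : env_add (env_pi u) (env_pi v) = env_pi (PAdd u v).
Proof. by apply/env_piP; apply: rel_add; apply: env_repr_pi. Qed.
Lemma env_piZ a u : env_scale a (env_pi u) = env_pi (PScale a u).
Proof. by apply/env_piP; apply: rel_scale; apply: env_repr_pi. Qed.
Lemma env_piM u v : env_mul (env_pi u) (env_pi v) = env_pi (PMul u v).
Proof. by apply/env_piP; apply: rel_mul; apply: env_repr_pi. Qed.

Lemma env_ind (P : env -> Prop) : (forall u, P (env_pi u)) -> forall u, P u.
Proof. by move=> H u; rewrite -(env_reprK u). Qed.

Lemma env_addA : associative env_add.
Proof.
elim/env_ind=> u; elim/env_ind=> v; elim/env_ind=> w.
by rewrite !env_piD; apply/env_piP/rel_addA.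
Qed.
Lemma env_addC : commutative env_add.
Proof.
by elim/env_ind=> u; elim/env_ind=> v; rewrite !env_piD; apply/env_piP/rel_addC.
Qed.
Lemma env_add0 : left_id env_zero env_add.
Proof. by elim/env_ind=> u; rewrite !env_piD; apply/env_piP/rel_add0. Qed.
Lemma env_addN : left_inverse env_zero (env_scale (-1)) env_add.
Proof.
elim/env_ind=> u; rewrite env_piZ env_piD; apply/env_piP.
apply: rel_trans (rel_scale0 u); rewrite -[0](addNr 1); apply: rel_sym.
apply: rel_trans (rel_scaleDl _ _ _) _; apply: rel_add; first exact: rel_refl.
exact: rel_scale1.
Qed.

HB.instance Definition _ :=
  GRing.isZmodule.Build env env_addA env_addC env_add0 env_addN.

Lemma env_mulA : associative env_mul.
Proof.
elim/env_ind=> u; elim/env_ind=> v; elim/env_ind=> w.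
by rewrite !env_piM; apply/env_piP/rel_mulA.
Qed.
Lemma env_mul1l : left_id env_one env_mul.
Proof. by elim/env_ind=> u; rewrite !env_piM; apply/env_piP/rel_mul1l. Qed.
Lemma env_mul1r : right_id env_one env_mul.
Proof. by elim/env_ind=> u; rewrite !env_piM; apply/env_piP/rel_mul1r. Qed.
Lemma env_mulDl : left_distributive env_mul env_add.
Proof.
elim/env_ind=> u; elim/env_ind=> v; elim/env_ind=> w.
by rewrite !(env_piM, env_piD); apply/env_piP/rel_mulDl.
Qed.
Lemma env_mulDr : right_distributive env_mul env_add.
Proof.
elim/env_ind=> u; elim/env_ind=> v; elim/env_ind=> w.
by rewrite !(env_piM, env_piD); apply/env_piP/rel_mulDr.
Qed.

Lemma env_scaleA a b u : env_scale a (env_scale b u) = env_scale (a * b) u.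
Proof.
by elim/env_ind: u => u; rewrite !env_piZ; apply/env_piP/rel_scaleA.
Qed.
Lemma env_scale1 : left_id 1 env_scale.
Proof. by elim/env_ind=> u; rewrite !env_piZ; apply/env_piP/rel_scale1. Qed.
Lemma env_scaleDr : right_distributive env_scale env_add.
Proof.
move=> a; elim/env_ind=> u; elim/env_ind=> v.
by rewrite !(env_piD, env_piZ); apply/env_piP/rel_scaleDr.
Qed.
Lemma env_scaleDl u : {morph env_scale^~ u : a b / a + b >-> env_add a b}.
Proof.
elim/env_ind: u => u a b.
by rewrite !(env_piD, env_piZ); apply/env_piP/rel_scaleDl.
Qed.

Section Eval.
Variables (A : algType F) (f : g -> A).

Fixpoint env_eval (u : env_pre) : A :=
  match u with
  | PGen x => f x
  | PZero => 0
  | POne => 1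
  | PAdd u v => env_eval u + env_eval v
  | PScale a u => a *: env_eval u
  | PMul u v => env_eval u * env_eval v
  end.

Hypothesis f_linear : linear f.
Hypothesis f_sbr : forall p q x y, hcomp p x = x -> hcomp q y = y ->
  f x * f y - (-1) ^+ (p && q) *: (f y * f x) = f (sbr x y).

Lemma env_eval_rel u v : env_rel u v -> env_eval u = env_eval v.
Proof.
elim=> //=.
- by move=> ? ? ? _ -> _ ->.
- by move=> ? ? ? ? _ -> _ ->.
- by move=> ? ? ? _ ->.
- by move=> ? ? ? ? _ -> _ ->.
- by move=> *; rewrite addrA.
- by move=> *; rewrite addrC.
- by move=> *; rewrite add0r.
- by move=> *; rewrite scalerA.
- by move=> *; rewrite scale0r.
- by move=> *; rewrite scale1r.
- by move=> *; rewrite scalerDr.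
- by move=> *; rewrite scalerDl.
- by move=> *; rewrite mulrA.
- by move=> *; rewrite mul1r.
- by move=> *; rewrite mulr1.
- by move=> *; rewrite mulrDl.
- by move=> *; rewrite mulrDr.
- by move=> *; rewrite scalerAl.
- by move=> *; rewrite scalerAr.
- by move=> p q x y hx hy; rewrite scaleNr (f_sbr hx hy).
Qed.

End Eval.

Lemma env_oner_neq0 : env_one != env_zero.
Proof.
apply/eqP=> /env_piP /(@env_eval_rel F^o (fun=> 0)) /= H.
suff /eqP : (1 : F^o) = 0 by rewrite oner_eq0.
apply: H => [a x y|p q x y _ _]; last by rewrite !mulr0 scaler0 subr0.
by rewrite addr0; symmetry; apply: scaler0.
Qed.

HB.instance Definition _ := GRing.Zmodule_isNzRing.Build env
  env_mulA env_mul1l env_mul1r env_mulDl env_mulDr env_oner_neq0.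
HB.instance Definition _ := GRing.Zmodule_isLmodule.Build F env
  env_scaleA env_scale1 env_scaleDr env_scaleDl.

Lemma env_opE : ((forall u v : env, (u + v = env_add u v)%R)
  * (forall a (u : env), a *: u = env_scale a u)
  * (forall u v : env, (u * v = env_mul u v)%R))%type.
Proof. by []. Qed.

Lemma env_scaleAl (a : F) (u v : env) : a *: (u * v) = (a *: u) * v.
Proof.
elim/env_ind: u => u; elim/env_ind: v => v.
rewrite !env_opE !(env_piM, env_piZ).
exact/env_piP/rel_scaleAl.
Qed.
HB.instance Definition _ := GRing.Lmodule_isLalgebra.Build F env env_scaleAl.

Lemma env_scaleAr (a : F) (u v : env) : a *: (u * v) = u * (a *: v).
Proof.
elim/env_ind: u => u; elim/env_ind: v => v.
rewrite !env_opE !(env_piM, env_piZ).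
exact/env_piP/rel_scaleAr.
Qed.
HB.instance Definition _ := GRing.Lalgebra_isAlgebra.Build F env env_scaleAr.

Definition env_in (x : g) : env := env_pi (PGen x).

Lemma env_in_linear : linear env_in.
Proof.
move=> a x y; rewrite !env_opE /env_in !(env_piD, env_piZ).
exact/env_piP/rel_gen.
Qed.
HB.instance Definition _ :=
  GRing.isLinear.Build F g env *:%R env_in env_in_linear.

Lemma env_in_sbr p q x y : hcomp p x = x -> hcomp q y = y ->
  env_in x * env_in y - (-1) ^+ (p && q) *: (env_in y * env_in x)
  = env_in (sbr x y).
Proof.
move=> hx hy; rewrite -scaleNr.
rewrite !env_opE /env_in !(env_piM, env_piZ, env_piD).
exact/env_piP/(rel_sbr hx hy).
Qed.

Definition env_lift (A : algType F) (f : g -> A) (u : env) : A :=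
  env_eval f (env_repr u).

Section Lift.
Variables (A : algType F) (f : g -> A).
Hypothesis f_linear : linear f.
Hypothesis f_sbr : forall p q x y, hcomp p x = x -> hcomp q y = y ->
  f x * f y - (-1) ^+ (p && q) *: (f y * f x) = f (sbr x y).

Let lift_pi u : env_lift f (env_pi u) = env_eval f u.
Proof. by apply: env_eval_rel => //; apply: env_repr_pi. Qed.

Lemma env_liftE x : env_lift f (env_in x) = f x.
Proof. exact: lift_pi. Qed.

Lemma env_lift_linear : linear (env_lift f).
Proof.
move=> a; elim/env_ind=> u; elim/env_ind=> v.
by rewrite !env_opE !(env_piD, env_piZ) !lift_pi.
Qed.

Lemma env_lift_monoid : monoid_morphism (env_lift f).
Proof.
split=> [|u v]; first exact: (lift_pi POne).
elim/env_ind: u => u; elim/env_ind: v => v.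
by rewrite !env_opE env_piM !lift_pi.
Qed.

End Lift.

Lemma env_lift_unique (A : algType F) (h1 h2 : {lrmorphism env -> A}) :
  (forall x, h1 (env_in x) = h2 (env_in x)) -> h1 =1 h2.
Proof.
move=> h12; elim/env_ind; elim=> [x|||u hu v hv|a u hu|u hu v hv].
- exact: h12.
- by rewrite (_ : env_pi _ = 0) // !raddf0.
- by rewrite (_ : env_pi _ = 1) // !rmorph1.
- by rewrite -env_piD -/(env_pi u + env_pi v) !raddfD /= hu hv.
- by rewrite -env_piZ -/(a *: env_pi u) !linearZ /= hu.
- by rewrite -env_piM -/(env_pi u * env_pi v) !rmorphM /= hu hv.
Qed.

(* The parity automorphism of U(g), u |-> (-1)^{|u|} u for homogeneous u. *)
Definition env_sigma : env -> env :=
  env_lift (fun x => env_in (hcomp false x - hcomp true x)).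

Lemma sigma_subproof_linear :
  linear (fun x => env_in (hcomp false x - hcomp true x)).
Proof.
move=> a x y; rewrite !hcomp_linear opprD addrACA -scalerBr.
exact: env_in_linear.
Qed.

Lemma hcomp_hom p (x : g) : hcomp p x = x ->
  hcomp false x - hcomp true x = (-1) ^+ p *: x.
Proof.
by move=> <-; rewrite !hcompK; case: p => /=;
  rewrite ?expr1 ?expr0 ?scaleN1r ?scale1r ?sub0r ?subr0.
Qed.

Lemma sigma_subproof_sbr p q x y : hcomp p x = x -> hcomp q y = y ->
  let f x := env_in (hcomp false x - hcomp true x) in
  f x * f y - (-1) ^+ (p && q) *: (f y * f x) = f (sbr x y).
Proof.
move=> hx hy f; rewrite /f (hcomp_hom hx) (hcomp_hom hy).
rewrite (hcomp_hom (sbr_hom hx hy)) !linearZ /= -(env_in_sbr hx hy).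
rewrite -!scalerAl -!scalerAr !scalerA scalerBr !scalerA signr_addb.
by rewrite -scaleNr; congr (_ + _ *: _); ring.
Qed.

Fact env_sigma_linear : linear env_sigma.
Proof. exact: env_lift_linear sigma_subproof_linear sigma_subproof_sbr. Qed.
Fact env_sigma_monoid : monoid_morphism env_sigma.
Proof. exact: env_lift_monoid sigma_subproof_linear sigma_subproof_sbr. Qed.
HB.instance Definition _ :=
  GRing.isLinear.Build F env env *:%R env_sigma env_sigma_linear.
HB.instance Definition _ :=
  GRing.isMonoidMorphism.Build env env env_sigma env_sigma_monoid.

Lemma env_sigma_in p x : hcomp p x = x ->
  env_sigma (env_in x) = (-1) ^+ p *: env_in x.
Proof.
move=> hx; rewrite /env_sigma env_liftE ?(hcomp_hom hx) ?linearZ //.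
  exact: sigma_subproof_linear.
exact: sigma_subproof_sbr.
Qed.

(* The adjoint action of a homogeneous x of parity p on U(g),
   z |-> x z - (-1)^{p|z|} z x. *)
Definition env_ad (p : bool) (x : g) (z : env) : env :=
  env_in x * z - iter p env_sigma z * env_in x.

(* U(g)^g *)
Definition supercenter : set env :=
  [set z | forall p x, hcomp p x = x -> env_ad p x z = 0].

End Envelope.

Definition subalgebra (F : pzRingType) (A : algType F) : set (set A) :=
  [set S : set A | [/\ S 1,
    forall (a : F) u v, S u -> S v -> S (a *: u + v) &
    forall u v, S u -> S v -> S (u * v)]]%classic.

Definition gl (F : numFieldType) (m n : nat) : Type := 'M[F]_(m + n).

Section GL.
Variables (F : numFieldType) (m n : nat).
Notation N := (m + n)%N.
Notation gl := (gl F m n).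

HB.instance Definition _ := GRing.Lmodule.on gl.

(* The basis of V = F^{m|n} is indexed from 0. *)
Definition par (i : 'I_N) : bool := (m <= i)%N.

Definition gl_hcomp (p : bool) (X : gl) : gl :=
  \matrix_(i, j) if par i (+) par j == p then X i j else 0.

Definition gl_sbr (X Y : gl) : gl :=
  \sum_(p : bool) \sum_(q : bool)
    (gl_hcomp p X *m gl_hcomp q Y
     - (-1) ^+ (p && q) *: (gl_hcomp q Y *m gl_hcomp p X)).

Lemma gl_hcomp_linear p : linear (gl_hcomp p).
Proof.
move=> a X Y; apply/matrixP=> i j; rewrite !mxE.
by case: eqP => //; rewrite mulr0 addr0.
Qed.
Lemma gl_hcompK p q X :
  gl_hcomp p (gl_hcomp q X) = if p == q then gl_hcomp p X else 0.
Proof.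
by apply/matrixP=> i j; case: eqP => pq; rewrite !mxE; do ![case: eqP => // ?];
  congruence.
Qed.
Lemma gl_hcompD X : gl_hcomp false X + gl_hcomp true X = X.
Proof.
by apply/matrixP=> i j; rewrite !mxE; case: (_ (+) _) => /=;
  rewrite ?add0r ?addr0.
Qed.

HB.instance Definition _ p :=
  GRing.isLinear.Build F gl gl *:%R (gl_hcomp p) (gl_hcomp_linear p).

Lemma gl_hcompM p q X Y : gl_hcomp p X = X -> gl_hcomp q Y = Y ->
  gl_hcomp (p (+) q) (X *m Y) = X *m Y.
Proof.
move=> <- <-; apply/matrixP=> i j; rewrite !mxE; case: eqP => // pq.
rewrite big1 // => k _; rewrite !mxE.
case: eqP => [pX|]; last by rewrite mul0r.
case: eqP => [pY|]; last by rewrite mulr0.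
by case: pq; rewrite -pX -pY addbA addbK.
Qed.

Lemma gl_sbr_homE p q X Y : gl_hcomp p X = X -> gl_hcomp q Y = Y ->
  gl_sbr X Y = X *m Y - (-1) ^+ (p && q) *: (Y *m X).
Proof.
move=> hX hY; rewrite /gl_sbr (bigD1 p) //= (bigD1 q) //= hX hY.
rewrite [X in _ + X]big1 => [|p' np]; last first.
  by rewrite big1 // => q' _; rewrite -hX gl_hcompK (negPf np) mulmx0 mul0mx
    scaler0 subr0.
rewrite big1 ?addr0 // => q' nq.
by rewrite -hY gl_hcompK (negPf nq) mulmx0 mul0mx scaler0 subr0.
Qed.

Lemma gl_sbr_linearl Y : linear (gl_sbr^~ Y).
Proof.
move=> a X X'; rewrite /gl_sbr scaler_sumr -big_split; apply: eq_bigr => p _ /=.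
rewrite scaler_sumr -big_split; apply: eq_bigr => q _ /=.
rewrite gl_hcomp_linear mulmxDl mulmxDr -scalemxAl -scalemxAr.
by rewrite scalerBr scalerDr !scalerA opprD addrACA mulrC.
Qed.
Lemma gl_sbr_linearr X : linear (gl_sbr X).
Proof.
move=> a Y Y'; rewrite /gl_sbr scaler_sumr -big_split; apply: eq_bigr => p _ /=.
rewrite scaler_sumr -big_split; apply: eq_bigr => q _ /=.
rewrite gl_hcomp_linear mulmxDl mulmxDr -scalemxAl -scalemxAr.
by rewrite scalerBr scalerDr !scalerA opprD addrACA mulrC.
Qed.

Lemma gl_sbr_hom p q X Y : gl_hcomp p X = X -> gl_hcomp q Y = Y ->
  gl_hcomp (p (+) q) (gl_sbr X Y) = gl_sbr X Y.
Proof.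
move=> hX hY; rewrite (gl_sbr_homE hX hY) linearB linearZ /= gl_hcompM //.
by rewrite addbC gl_hcompM.
Qed.

Lemma gl_sbr_skew p q X Y : gl_hcomp p X = X -> gl_hcomp q Y = Y ->
  gl_sbr X Y = - ((-1) ^+ (p && q) *: gl_sbr Y X).
Proof.
move=> hX hY; rewrite (gl_sbr_homE hX hY) (gl_sbr_homE hY hX).
rewrite scalerBr scalerA [q && p]andbC -signr_addb addbb scale1r.
by rewrite opprB.
Qed.

Lemma gl_sbr_jacobi p q X Y Z : gl_hcomp p X = X -> gl_hcomp q Y = Y ->
  gl_sbr X (gl_sbr Y Z)
  = gl_sbr (gl_sbr X Y) Z + (-1) ^+ (p && q) *: gl_sbr Y (gl_sbr X Z).
Proof.
move=> hX hY.
have sD W Z1 Z2 : gl_sbr W (Z1 + Z2) = gl_sbr W Z1 + gl_sbr W Z2.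
  by rewrite -[Z1 in LHS]scale1r gl_sbr_linearr scale1r.
suff hom r W : gl_hcomp r W = W -> gl_sbr X (gl_sbr Y W)
  = gl_sbr (gl_sbr X Y) W + (-1) ^+ (p && q) *: gl_sbr Y (gl_sbr X W).
  rewrite -[Z]gl_hcompD !sD scalerDr addrACA.
  by rewrite (hom false) ?(hom true) // gl_hcompK eqxx.
move=> hW; have hYW := gl_sbr_hom hY hW; have hXW := gl_sbr_hom hX hW.
have hXY := gl_sbr_hom hX hY.
rewrite (gl_sbr_homE hX hYW) (gl_sbr_homE hXY hW) (gl_sbr_homE hY hXW).
rewrite (gl_sbr_homE hX hY) (gl_sbr_homE hX hW) (gl_sbr_homE hY hW).
rewrite !(mulmxBl, mulmxBr) -!scalemxAl -!scalemxAr !mulmxA.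
rewrite !scalerBr !scalerA.
set a := X *m Y *m W; set b := X *m W *m Y; set c := Y *m X *m W.
set d := Y *m W *m X; set e := W *m X *m Y; set f := W *m Y *m X.
apply/matrixP=> i j; rewrite !mxE.
by case: p q r {hX hY hW hYW hXW hXY} => [] [] [] /=; ring.
Qed.

HB.instance Definition _ := Lmodule_isLieSuper.Build F gl
  gl_hcomp_linear gl_hcompK gl_hcompD gl_sbr_linearl gl_sbr_linearr
  gl_sbr_hom gl_sbr_skew gl_sbr_jacobi.

Definition glE (i j : 'I_N) : gl := delta_mx i j.

Lemma glE_hom i j : hcomp (par i (+) par j) (glE i j) = glE i j.
Proof.
apply/matrixP=> k l; rewrite !mxE.
by case: (k =P i) => [->|] /=; case: (l =P j) => [->|] /=; rewrite ?eqxx ?if_same.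
Qed.

Lemma glE_sbr i j k l : sbr (glE i j) (glE k l) =
  (j == k)%:R *: glE i l
  - (-1) ^+ ((par i (+) par j) && (par k (+) par l)) *:
      ((l == i)%:R *: glE k j).
Proof.
rewrite [LHS](gl_sbr_homE (glE_hom i j) (glE_hom k l)) /glE.
have dE a b c d : delta_mx a b *m delta_mx c d
    = (b == c)%:R *: delta_mx a d :> 'M[F]_N.
  by case: eqP => [->|/eqP bc]; rewrite ?mul_delta_mx ?mul_delta_mx_0 ?scale1r
    ?scale0r.
by rewrite !dE.
Qed.

Notation U := (env gl).

Definition E (i j : 'I_N) : U := env_in (glE i j).

(* A matrix [A : 'M[U]_N] stands for \sum_(i, j) e_ij \otimes A i j in
   End(V) \otimes U.  The sign (-1)^{|e_jl| |A i j|} of the product of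
   e_ij \otimes A i j and e_jl \otimes B j l is carried by [env_sigma]. *)
Definition stens_mul (A B : 'M[U]_N) : 'M[U]_N :=
  \matrix_(i, l) \sum_j iter (par j (+) par l) (@env_sigma F gl) (A i j) * B j l.

Definition stens_one : 'M[U]_N := \matrix_(i, j) (i == j)%:R.

Definition stens_exp (A : 'M[U]_N) (k : nat) : 'M[U]_N :=
  iter k (stens_mul A) stens_one.

Definition Ehat : 'M[U]_N :=
  \matrix_(i, j) ((-1) ^+ ((par i && par j) (+) par i (+) par j) *: E i j).

Definition Str (A : 'M[U]_N) : U := \sum_i (-1) ^+ par i *: A i i.

(* e_ij \otimes u *)
Definition stens (i j : 'I_N) (u : U) : 'M[U]_N :=
  \matrix_(i', j') (if (i' == i) && (j' == j) then u else 0).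

Lemma stens_mulE i j k l (p : bool) (a b : U) :
  env_sigma a = (-1) ^+ p *: a ->
  stens_mul (stens i j a) (stens k l b) =
  if j == k then stens i l ((-1) ^+ ((par k (+) par l) && p) *: (a * b)) else 0.
Proof.
move=> ha; have ha' (q : bool) : iter q (@env_sigma F gl) a = (-1) ^+ (q && p) *: a.
  by case: q; rewrite ?scale1r.
have h0 (q : bool) : iter q (@env_sigma F gl) 0 = 0 by case: q; rewrite //= raddf0.
apply/matrixP=> i' l'; rewrite mxE (bigD1 j) //= big1 => [|j' nj]; last first.
  by rewrite !mxE (negPf nj) andbF h0 mul0r.
rewrite !mxE eqxx andbT addr0; case: (j =P k) => [<-|] /=; last first.
  by rewrite mulr0 mxE.
rewrite mxE; case: (i' =P i) => [_|_] /=; last by rewrite h0 mul0r.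
by case: (l' =P l) => [->|]; rewrite ?mulr0 // ha' scalerAl.
Qed.

(* E_{i s_1} E_{s_1 s_2} ... E_{s_k l} *)
Fixpoint Epath (i : 'I_N) (s : seq 'I_N) (l : 'I_N) : U :=
  if s is j :: s' then E i j * Epath j s' l else E i l.

Lemma Ehat_expE k i l : stens_exp Ehat k.+1 i l =
  (-1) ^+ ((par i && par l) (+) par i (+) par l) *:
  \sum_(t : k.-tuple 'I_N) (-1) ^+ (\sum_(j <- t) par j)%N *: Epath i t l.
Proof.
have sE (b : bool) j j' : iter b (@env_sigma F gl) (E j j')
    = (-1) ^+ (b && (par j (+) par j')) *: E j j'.
  by case: b => /=; rewrite ?scale1r // (env_sigma_in (glE_hom _ _)).
have sZ (b : bool) a u : iter b (@env_sigma F gl) (a *: u)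
    = a *: iter b (@env_sigma F gl) u.
  by case: b => //=; rewrite linearZ.
elim: k i => [|k IH] i.
  rewrite /stens_exp /= mxE (bigD1 l) //= big1 => [|j nj]; last first.
    by rewrite !mxE (negPf nj) mulr0.
  rewrite !mxE eqxx addr0 mulr1 addbb /=; congr (_ *: _).
  rewrite (bigD1 [tuple]) //= big_nil scale1r big1 ?addr0 // => t /eqP[].
  exact: tuple0.
rewrite /stens_exp iterS -/(stens_exp _ _) mxE.
pose cons2 (p : 'I_N * k.-tuple 'I_N) := [tuple of p.1 :: p.2].
rewrite (reindex cons2) /=; last first.
  exists (fun t => (thead t, [tuple of behead t])) => [[j t] _|t _] /=.
    by congr (_, _); apply/val_inj.
  by rewrite /cons2 /= -tuple_eta.
rewrite -(pair_bigA _ (fun (j : 'I_N) (t : k.-tuple 'I_N) =>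
    (-1) ^+ (\sum_(i <- j :: t) par i)%N
      *: Epath i (j :: t) l)) /= scaler_sumr.
apply: eq_bigr => j _; rewrite IH mxE sZ sE -!scalerAl -scalerAr !scalerA.
rewrite !scaler_sumr mulr_sumr scaler_sumr; apply: eq_bigr => t _.
rewrite big_cons -scalerAr !scalerA exprD; congr (_ *: _).
rewrite !mulrA; congr (_ * _).
by case: (par i); case: (par j); case: (par l) => /=;
  rewrite ?expr0 ?expr1 ?mulr1 ?mul1r ?mulrN1 ?opprK.
Qed.

Lemma Str_EhatE k : Str (stens_exp Ehat k.+1) =
  \sum_l \sum_(t : k.-tuple 'I_N)
    (-1) ^+ (\sum_(j <- t) par j)%N *: Epath l t l.
Proof.
apply: eq_bigr => l _; rewrite Ehat_expE scalerA -signr_addb.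
by case: (par l); rewrite /= scale1r.
Qed.

End GL.

Arguments Ehat F m n : clear implicits.

(* Main.v *)
Require Import Defs.
From HB Require Import structures.
From mathcomp Require Import all_boot all_order all_algebra.
From mathcomp Require Import mxtens ring perm.

(** Write U_d for the span of the products of at most d elements of gl_{m|n}.
    A central z in U_d is the image of some T in End(V)^{\otimes d}, modulo
    U_{d-1}.  The inclusion-exclusion sum over the sets of tensor factors on which
    z acts kills U_{d-1} and sends z to the symmetrization of T, which is thus
    invariant under gl_{m|n}; this replaces the Poincare-Birkhoff-Witt theorem.
    The commutant of the super flips consists of the symmetrized tensors, and
    these are polynomials in the action of gl_{m|n}; so an invariant lies in the
    double commutant of the flips, which is the algebra they generate, by an
    averaging argument of Maschke type.  Modulo U_{d-1} the map to U_d is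
    invariant under conjugation by flips, so that an element of this algebra can
    be replaced by a combination of products of cycles on consecutive positions,
    whose images are products of supertraces of powers.  Subtracting these lowers
    the degree of z. *)
Set Implicit Arguments.
Unset Strict Implicit.
Unset Printing Implicit Defensive.

Import GRing.Theory Num.Theory.
Local Open Scope ring_scope.

(** * Operators on tensor powers *)

(** The tensor T attached to z is not unique, so its invariance cannot be read off directly. Its
    symmetrization is determined by z itself: gl_{m|n} is all of End(V), and on V^{\otimes d} a
    product of d elements is visible up to reordering by letting each of them act on its own factor.
    Dividing later by the number of reorderings uses characteristic 0.

    The flips enter through words rather than through a group. Averaging needs a finite family of
    words, paired with their inverses, that is stable under multiplication by a flip. Such a family
    arises by sorting the positions in the inclusion-exclusion sum, and its stability, up to linear
    relations between the operators, follows from the fact that this sum favours no position. *)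

Section TensorPower.
Variables (F : numFieldType) (m n : nat).
Notation N := (m + n)%N.
Notation gl := (gl F m n).

Fixpoint tdim (d : nat) : nat := if d is d'.+1 then (N * tdim d')%N else 1%N.
Notation M d := 'M[F]_(tdim d).

Definition tidx d (a : 'I_N) (i : 'I_(tdim d)) : 'I_(tdim d.+1) :=
  mxtens_index (a, i).

Lemma tidxP d (i : 'I_(tdim d.+1)) : exists a j, i = tidx a j.
Proof. by case: (mxtens_indexP i) => a j; exists a, j. Qed.

Lemma tidx_eq d a b (i j : 'I_(tdim d)) :
  (tidx a i == tidx b j) = (a == b) && (i == j).
Proof. by rewrite (can_eq (@mxtens_indexK _ _)) xpair_eqE. Qed.

Definition tcons d (x : 'M[F]_N) (Y : M d) : M d.+1 := tensmx x Y.

Lemma tconsE d (x : 'M[F]_N) (Y : M d) i j k l :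
  tcons x Y (tidx i j) (tidx k l) = x i k * Y j l.
Proof. exact: tensmxE. Qed.

Lemma tconsM d x x' (Y Y' : M d) :
  tcons x Y *m tcons x' Y' = tcons (x *m x') (Y *m Y').
Proof. exact: tensmx_mul. Qed.

Lemma tcons_linearl d (Y : M d) : linear (fun x : 'M[F]_N => tcons x Y).
Proof. by move=> a x y; apply/matrixP=> i j; rewrite !mxE mulrDl mulrA. Qed.

Lemma tcons_linearr d (x : 'M[F]_N) : linear (@tcons d x).
Proof. by move=> a Y Z; apply/matrixP=> i j; rewrite !mxE mulrDr mulrCA. Qed.

HB.instance Definition _ d x :=
  GRing.isLinear.Build F (M d) (M d.+1) *:%R (@tcons d x) (@tcons_linearr d x).

Lemma tens0E (T : M 0) : T = T ord0 ord0 *: 1%:M.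
Proof.
apply/matrixP=> i j; rewrite mxE.
have -> : i = ord0 by exact: ord1.
have -> : j = ord0 by exact: ord1.
by rewrite mxE mulr1.
Qed.

Lemma tconsDl d x y (Y : M d) : tcons (x + y) Y = tcons x Y + tcons y Y.
Proof. by have := tcons_linearl Y 1 x y; rewrite !scale1r. Qed.

Lemma tcons0l d (Y : M d) : tcons 0 Y = 0.
Proof. by apply: (@addrI _ (tcons 0 Y)); rewrite -tconsDl !addr0. Qed.

Lemma tconsZl d a x (Y : M d) : tcons (a *: x) Y = a *: tcons x Y.
Proof. by have := tcons_linearl Y a x 0; rewrite tcons0l !addr0. Qed.

Lemma tcons1 d : tcons 1%:M (1%:M : M d) = 1%:M.
Proof.
apply/matrixP=> i j; have [i0 [i1 ->]] := tidxP i.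
have [j0 [j1 ->]] := tidxP j.
rewrite tconsE !mxE.
rewrite tidx_eq; by do 2![case: eqP => _]; rewrite ?mulr1 ?mulr0.
Qed.

Definition tblock d (a b : 'I_N) (T : M d.+1) : M d :=
  \matrix_(i, j) T (tidx a i) (tidx b j).

Lemma tblock_linear d a b : linear (@tblock d a b).
Proof. by move=> c T T'; apply/matrixP=> i j; rewrite !mxE. Qed.
HB.instance Definition _ d a b :=
  GRing.isLinear.Build F (M d.+1) (M d) *:%R (@tblock d a b) (@tblock_linear d a b).

Lemma tblockE d a b (x : 'M[F]_N) (Y : M d) : tblock a b (tcons x Y) = x a b *: Y.
Proof. by apply/matrixP=> i j; rewrite mxE tconsE mxE. Qed.

Lemma tblock_sum d (T : M d.+1) :
  T = \sum_a \sum_b tcons (glE F a b) (tblock a b T).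
Proof.
apply/matrixP=> i j; have [i0 [i1 ->]] := tidxP i.
have [j0 [j1 ->]] := tidxP j.
rewrite summxE (bigD1 i0) //=.
rewrite summxE (bigD1 j0) //= !big1 ?addr0.
- by rewrite tconsE !mxE !eqxx mul1r.
- move=> a na; rewrite summxE big1 // => b _.
  by rewrite tconsE !mxE [i0 == _]eq_sym (negPf na) mul0r.
by move=> b nb; rewrite tconsE !mxE [j0 == _]eq_sym (negPf nb) andbF mul0r.
Qed.

Definition parJ : gl := \matrix_(i, j) (if i == j then (-1) ^+ par i else 0).

Fixpoint parK d : M d := if d is d'.+1 then tcons parJ (parK d') else 1%:M.

(** The power of the parity operator that an element of parity p leaves on the tensor factors after
    it. *)
Definition parKX d (p : bool) : M d := if p then parK d else 1%:M.

Lemma parJ_mull (x : gl) i j : (parJ *m x) i j = (-1) ^+ par i * x i j.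
Proof.
rewrite mxE (bigD1 i) //= !mxE eqxx big1 ?addr0 // => k nk.
by rewrite mxE eq_sym (negPf nk) mul0r.
Qed.

Lemma parJ_mulr (x : gl) i j : (x *m parJ) i j = (-1) ^+ par j * x i j.
Proof.
rewrite mxE (bigD1 j) //= !mxE eqxx big1 ?addr0 1?mulrC // => k nk.
by rewrite mxE (negPf nk) mulr0.
Qed.

Lemma hcomp_par p (x : gl) i j : hcomp p x = x ->
  x i j != 0 -> par i (+) par j = p.
Proof. by move=> <-; rewrite mxE; case: (_ =P p); rewrite ?eqxx. Qed.

Lemma parJ_hom p (x : gl) : hcomp p x = x -> parJ *m x = (-1) ^+ p *: (x *m parJ).
Proof.
move=> hx; apply/matrixP=> i j; rewrite [RHS]mxE parJ_mull parJ_mulr.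
have [->|] := eqVneq (x i j) 0; first by rewrite !mulr0.
move/(hcomp_par hx) => <-; rewrite mulrA -signr_addb.
by case: (par i); case: (par j).
Qed.

Lemma parJK : parJ *m parJ = 1%:M.
Proof.
apply/matrixP=> i j; rewrite parJ_mull !mxE; case: eqP => _; last by rewrite mulr0.
by rewrite -expr2 sqrr_sign.
Qed.

Lemma parJ_even : hcomp false parJ = parJ.
Proof.
by apply/matrixP=> i j; rewrite !mxE; case: (i =P j) => [->|_]; rewrite ?addbb ?if_same.
Qed.

Lemma gl1_even : hcomp false (1%:M : gl) = 1%:M.
Proof.
by apply/matrixP=> i j; rewrite !mxE; case: (i =P j) => [->|_]; rewrite ?addbb ?if_same.
Qed.

Lemma parKK d : parK d *m parK d = 1%:M.
Proof. by elim: d => [|d IH] /=; rewrite ?mulmx1 // tconsM parJK IH tcons1. Qed.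

Lemma parKX_mul d p q : parKX d p *m parKX d q = parKX d (p (+) q).
Proof. by case: p q => [] []; rewrite /= ?parKK ?mul1mx ?mulmx1. Qed.

(* [op d i x] lets x act on the i-th tensor factor of V^{\otimes d}; the sign
   rule is implemented by the parity operator on the factors after it. *)
Fixpoint op d : nat -> gl -> M d :=
  if d is d'.+1 then fun i x =>
    if i is i'.+1 then tcons 1%:M (op d' i' x)
    else \sum_(p : bool) tcons (hcomp p x) (parKX d' p)
  else fun _ _ => 0.

Lemma op_linear d i : linear (op d i).
Proof.
elim: d i => [|d IH] [|i] a x y; rewrite /= ?scaler0 ?addr0 //.
  rewrite scaler_sumr -big_split; apply: eq_bigr => p _.
  by rewrite linearP tconsDl tconsZl.
by rewrite IH linearP.
Qed.
HB.instance Definition _ d i :=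
  GRing.isLinear.Build F gl (M d) *:%R (op d i) (@op_linear d i).

Lemma op0_hom d p (x : gl) : hcomp p x = x -> op d.+1 0 x = tcons x (parKX d p).
Proof.
move=> hx; rewrite /= (bigD1 p) //= hx big1 ?addr0 // => q nq.
by rewrite -hx hcompK (negPf nq) tcons0l.
Qed.

Lemma hcomp_idem p (x : gl) : hcomp p (hcomp p x) = hcomp p x.
Proof. by rewrite hcompK eqxx. Qed.

Lemma hcomp_mul p q (x y : gl) : hcomp p x = x -> hcomp q y = y ->
  hcomp (p (+) q) (x *m y : gl) = x *m y.
Proof. exact: gl_hcompM. Qed.

Lemma glhom_ind (P : gl -> Prop) : (forall x y, P x -> P y -> P (x + y)) ->
  (forall p x, hcomp p x = x -> P x) -> forall x, P x.
Proof. by move=> PD Ph x; rewrite -(hcompD x); apply: PD; apply: Ph (hcomp_idem _ _). Qed.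

Lemma op_mul d i x y : op d i x *m op d i y = op d i (x *m y).
Proof.
elim/glhom_ind: x => [x x'|p x hx].
  by move=> hx hx'; rewrite mulmxDl !raddfD /= mulmxDl hx hx'.
elim/glhom_ind: y => [y y'|q y hy].
  move=> hy hy'; have -> : x *m (y + y') = x *m y + x *m y' :> gl.
    exact: mulmxDr.
  by rewrite !raddfD /= hy hy'.
elim: d i => [|d IH] [|i]; rewrite ?mul0mx //.
  rewrite (op0_hom _ hx) (op0_hom _ hy) tconsM parKX_mul.
  by rewrite (op0_hom _ (hcomp_mul hx hy)).
by rewrite /= tconsM mul1mx IH.
Qed.

Lemma op1 d i : (i < d)%N -> op d i 1%:M = 1%:M.
Proof.
elim: d i => [|d IH] [|i] // id.
  by rewrite (op0_hom _ gl1_even) tcons1.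
by rewrite /= IH // tcons1.
Qed.

Lemma parK_op d i p x : hcomp p x = x ->
  parK d *m op d i x = (-1) ^+ p *: (op d i x *m parK d).
Proof.
move=> hx; elim: d i => [|d IH] [|i]; rewrite ?mulmx0 ?mul0mx ?scaler0 //.
  rewrite (op0_hom _ hx) /= !tconsM (parJ_hom hx) tconsZl; congr (_ *: tcons _ _).
  by case: (p) => //=; rewrite mulmx1 mul1mx.
by rewrite /= !tconsM IH mulmx1 mul1mx linearZ.
Qed.

Lemma parKX_op d i p q x : hcomp p x = x ->
  parKX d q *m op d i x = (-1) ^+ (p && q) *: (op d i x *m parKX d q).
Proof.
case: q => hx; rewrite /= ?andbT ?andbF; first exact: parK_op.
by rewrite mul1mx mulmx1 scale1r.
Qed.

Lemma op_comm d i j p q x y : hcomp p x = x -> hcomp q y = y -> i != j ->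
  op d i x *m op d j y = (-1) ^+ (p && q) *: (op d j y *m op d i x).
Proof.
move=> hx hy; elim: d i j => [|d IH] [|i] [|j] // ij;
  rewrite ?mulmx0 ?scaler0 //.
- rewrite (op0_hom _ hx) /= !tconsM mulmx1 mul1mx (parKX_op _ _ _ hy) linearZ /=.
  by rewrite andbC.
- rewrite (op0_hom _ hy) /= !tconsM mulmx1 mul1mx (parKX_op _ _ _ hx) linearZ /=.
  by rewrite scalerA -signr_addb addbb scale1r.
- by rewrite /= !tconsM (IH i j) // linearZ.
Qed.

Fixpoint tword d i (s : seq gl) : M d :=
  if s is x :: s' then op d i x *m tword d i.+1 s' else 1%:M.

Lemma tword_tcons d i s : tword d.+1 i.+1 s = tcons 1%:M (tword d i s).
Proof. by elim: s i => [|x s IH] i /=; rewrite ?tcons1 // IH tconsM mul1mx. Qed.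

Lemma tcons_op0 d p (x : gl) (Y : M d) : hcomp p x = x ->
  tcons x Y = op d.+1 0 x *m tcons 1%:M (parKX d p *m Y).
Proof.
move=> hx; rewrite (op0_hom _ hx) tconsM mulmx1 mulmxA parKX_mul addbb.
by rewrite mul1mx.
Qed.

Definition homl (s : seq gl) := forall x, x \in s -> exists p, hcomp p x = x.

(** The induction principle for linear statements about End(V)^{\otimes d}. A first factor x differs
    from the operator of x at position 0 by a parity operator on the rest, and this can be absorbed
    because the claim is proved for every rest. *)
Lemma tword_span d (P : M d -> Prop) : P 0 ->
  (forall a X Y, P X -> P Y -> P (a *: X + Y)) ->
  (forall s, size s = d -> homl s -> P (tword d 0 s)) -> forall T, P T.
Proof.
move=> P0 PZ Pw.
have PZ1 a X : P X -> P (a *: X) by move=> hX; rewrite -[_ *: X]addr0; apply: PZ.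
elim: d P P0 PZ Pw PZ1 => [|d IH] P P0 PZ Pw PZ1 T.
  rewrite (tens0E T); apply: PZ1.
  by apply: (Pw [::]).
have PD X Y : P X -> P Y -> P (X + Y).
  by move=> hX hY; rewrite -[X]scale1r; apply: PZ.
rewrite (tblock_sum T); apply: (big_ind P) => // a _; apply: (big_ind P) => // b _.
rewrite (tcons_op0 _ (glE_hom _ a b)).
move: (_ *m tblock _ _ _); apply: (IH (fun Y => P (_ *m tcons 1%:M Y))).
- by rewrite raddf0 mulmx0.
- by move=> c X Y hX hY; rewrite linearP mulmxDr -scalemxAr; apply: PZ.
- move=> s ss hs; rewrite -tword_tcons.
  apply: (Pw (glE F a b :: s)); rewrite /= ?ss // => x; rewrite inE.
  by case/predU1P=> [->|/hs //]; exists (par a (+) par b); apply: glE_hom.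
- by move=> c X hX; rewrite linearZ -scalemxAr; apply: PZ1.
Qed.

End TensorPower.

(** * Super flips: conjugation of operators and Coxeter relations *)

Section Swap.
Variables (F : numFieldType) (m n : nat).
Notation N := (m + n)%N.
Notation gl := (gl F m n).
Notation M d := 'M[F]_(tdim m n d).
Notation op := (@op F m n).
Notation glE := (@glE F m n).

Lemma gl_sum (x : gl) : x = \sum_a \sum_b x a b *: glE a b.
Proof. exact: matrix_sum_delta. Qed.

Lemma gl_ind (P : gl -> Prop) : P 0 -> (forall a x y, P x -> P y -> P (a *: x + y)) ->
  (forall a b, P (glE a b)) -> forall x, P x.
Proof.
move=> P0 PZ PE x; rewrite (gl_sum x).
have PD y z : P y -> P z -> P (y + z).
  by move=> hy hz; rewrite -[y]scale1r; apply: PZ.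
apply: (big_ind P) => // a _; apply: (big_ind P) => // b _.
by rewrite -[_ *: _]addr0; apply: PZ.
Qed.

Lemma opE_mul d i a b c e : op d i (glE a b) *m op d i (glE c e) =
  (b == c)%:R *: op d i (glE a e).
Proof.
rewrite op_mul -linearZ; congr (op _ _ _); rewrite /glE.
by case: eqP => [->|/eqP bc]; rewrite ?mul_delta_mx ?mul_delta_mx_0 ?scale1r ?scale0r.
Qed.

Lemma opE_comm d i j a b c e : i != j ->
  op d i (glE a b) *m op d j (glE c e) =
  (-1) ^+ ((par a (+) par b) && (par c (+) par e)) *:
    (op d j (glE c e) *m op d i (glE a b)).
Proof. exact: op_comm (glE_hom _ _ _) (glE_hom _ _ _). Qed.

Lemma sum_delta (V : lmodType F) (c : 'I_N) (G : 'I_N -> V) :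
  \sum_b (b == c)%:R *: G b = G c.
Proof.
rewrite (bigD1 c) //= eqxx scale1r big1 ?addr0 // => b nb.
by rewrite (negPf nb) scale0r.
Qed.

Lemma sum_delta' (V : lmodType F) (c : 'I_N) (G : 'I_N -> V) :
  \sum_b (c == b)%:R *: G b = G c.
Proof. by rewrite -[RHS]sum_delta; apply: eq_bigr => b _; rewrite eq_sym. Qed.

(* The super flip of the i-th and j-th tensor factors. *)
Definition flip d i j : M d :=
  \sum_a \sum_b (-1) ^+ par b *: (op d i (glE a b) *m op d j (glE b a)).

Lemma flip_sym d i j : i != j -> flip d i j = flip d j i.
Proof.
move=> ij; rewrite /flip exchange_big; apply: eq_bigr => a _; apply: eq_bigr => b _.
rewrite (opE_comm _ _ _ _ _ ij) scalerA -signr_addb; congr (_ ^+ _ *: _).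
by case: (par a); case: (par b).
Qed.

Lemma flip_opl d i j x : i != j -> flip d i j *m op d i x = op d j x *m flip d i j.
Proof.
move=> ij; have ji : j != i by rewrite eq_sym.
elim/gl_ind: x => [|r x y hx hy|c e].
- by rewrite !raddf0 mul0mx.
- by rewrite !linearP /= hx hy mulmxDl -scalemxAl.
rewrite /flip mulmx_suml mulmx_sumr; apply: eq_bigr => a _.
rewrite mulmx_suml mulmx_sumr.
(* For fixed [a], multiplying matrix units at equal positions leaves only b = c on the left side and
   only b = e on the right side; the two surviving signs agree for all parities. *)
transitivity ((-1) ^+ (par c (+) ((par c (+) par a) && (par c (+) par e))) *:
    (op d i (glE a e) *m op d j (glE c a))).
  rewrite -(sum_delta c (fun b => (-1) ^+ (par b (+) ((par b (+) par a) &&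
    (par c (+) par e))) *: (op d i (glE a e) *m op d j (glE b a)))).
  apply: eq_bigr => b _; rewrite -scalemxAl -mulmxA.
  rewrite (opE_comm _ _ _ _ _ ji) -scalemxAr mulmxA opE_mul.
  by rewrite -scalemxAl !scalerA signr_addb; congr (_ *: _); ring.
transitivity ((-1) ^+ (par e (+) ((par c (+) par e) && (par a (+) par e))) *:
    (op d i (glE a e) *m op d j (glE c a))).
  by congr (_ ^+ _ *: _); case: (par a); case: (par c); case: (par e).
rewrite -(sum_delta' e (fun b => (-1) ^+ (par b (+) ((par c (+) par e) &&
    (par a (+) par b))) *: (op d i (glE a b) *m op d j (glE c a)))).
apply: eq_bigr => b _; rewrite -scalemxAr mulmxA.
rewrite (opE_comm _ _ _ _ _ ji) -scalemxAl -mulmxA opE_mul.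
by rewrite -scalemxAr !scalerA signr_addb; congr (_ *: _); ring.
Qed.

Lemma flip_opr d i j x : i != j -> flip d i j *m op d j x = op d i x *m flip d i j.
Proof. by move=> ij; rewrite flip_sym // flip_opl 1?eq_sym. Qed.

Lemma flip_op d i j k (x : gl) : k != i -> k != j ->
  flip d i j *m op d k x = op d k x *m flip d i j.
Proof.
move=> ki kj; elim/glhom_ind: x => [x y hx hy|p x hx].
  by rewrite !raddfD /= hx hy mulmxDl.
rewrite /flip mulmx_suml mulmx_sumr; apply: eq_bigr => a _.
rewrite mulmx_suml mulmx_sumr; apply: eq_bigr => b _.
rewrite -scalemxAl -scalemxAr; congr (_ *: _).
rewrite [in RHS]mulmxA (op_comm _ hx (glE_hom _ _ _) ki) -scalemxAl -!mulmxA.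
rewrite (op_comm _ hx (glE_hom _ _ _) kj) -scalemxAr scalerA -signr_addb.
by case: p (par a) (par b) {hx} => [] [] []; rewrite /= scale1r.
Qed.

Lemma op_sum1 d k : (k < d)%N -> \sum_a op d k (glE a a) = 1%:M.
Proof.
move=> kd; rewrite -(@op1 F m n d k kd) (gl_sum 1%:M) raddf_sum; apply: eq_bigr => a _.
rewrite raddf_sum (bigD1 a) //= !mxE eqxx scale1r big1 ?addr0 // => b nb.
by rewrite !mxE eq_sym (negPf nb) scale0r raddf0.
Qed.

Lemma flipK d i j : i != j -> (i < d)%N -> (j < d)%N ->
  flip d i j *m flip d i j = 1%:M.
Proof.
move=> ij id jd.
transitivity ((\sum_a op d i (glE a a)) *m \sum_b op d j (glE b b)); last first.
  by rewrite !op_sum1 ?mulmx1.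
rewrite {1}/flip !mulmx_suml; apply: eq_bigr => a _.
rewrite mulmx_suml mulmx_sumr; apply: eq_bigr => b _.
pose G c e : M d := (-1) ^+ (par b (+) par e (+) ((par b (+) par a) && (par c (+) par e)))
  *: (op d i (glE a e) *m op d j (glE b c)).
transitivity (G b a); last first.
  rewrite /G; case: (par a) (par b) => [] [] /=; by rewrite scale1r.
have -> : G b a = \sum_c (b == c)%:R *: G c a by rewrite sum_delta'.
rewrite -scalemxAl /flip mulmx_sumr scaler_sumr.
apply: eq_bigr => c _; have -> : G c a = \sum_e (a == e)%:R *: G c e by rewrite sum_delta'.
rewrite mulmx_sumr !scaler_sumr.
apply: eq_bigr => e _; rewrite /G -scalemxAr -mulmxA [op d j _ *m (_ *m _)]mulmxA.
have ji : j != i by rewrite eq_sym.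
rewrite (opE_comm _ _ _ _ _ ji) -scalemxAl -scalemxAr -[_ *m op d j _ *m _]mulmxA.
rewrite opE_mul mulmxA opE_mul -scalemxAl -!scalemxAr !scalerA !signr_addb.
by congr (_ *: _); ring.
Qed.

Lemma flip_parK d i j : flip d i j *m parK F m n d = parK F m n d *m flip d i j.
Proof.
rewrite /flip mulmx_suml mulmx_sumr; apply: eq_bigr => a _.
rewrite mulmx_suml mulmx_sumr; apply: eq_bigr => b _.
rewrite -scalemxAl -scalemxAr; congr (_ *: _).
rewrite mulmxA (parK_op _ _ (glE_hom _ _ _)) -scalemxAl -[in RHS]mulmxA.
rewrite (parK_op _ _ (glE_hom _ _ _)) -scalemxAr scalerA -signr_addb mulmxA.
by case: (par a) (par b) => [] []; rewrite scale1r.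
Qed.

Lemma flipE d i j : flip d i j =
  \sum_a \sum_b (-1) ^+ par b *: (op d i (glE a b) *m op d j (glE b a)).
Proof. by []. Qed.

Lemma flip_sandwich d i j (A B : M d) : A *m flip d i j *m B = \sum_a \sum_b
  (-1) ^+ par b *: (A *m (op d i (glE a b) *m op d j (glE b a)) *m B).
Proof.
rewrite /flip mulmx_sumr mulmx_suml; apply: eq_bigr => a _.
rewrite mulmx_sumr mulmx_suml; apply: eq_bigr => b _.
by rewrite -scalemxAr -scalemxAl.
Qed.

(** Both sides are the flip of i and k, since conjugation by the outer flip renames one position of
    the middle one. *)
Lemma flip_braid d i j k : i != j -> i != k -> j != k ->
  (i < d)%N -> (j < d)%N -> (k < d)%N ->
  flip d i j *m flip d j k *m flip d i j = flip d j k *m flip d i j *m flip d j k.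
Proof.
move=> ij ik jk id jd kd; transitivity (flip d i k).
  rewrite flip_sandwich; apply: eq_bigr => a _; apply: eq_bigr => b _.
  congr (_ *: _); rewrite mulmxA flip_opr // -!mulmxA -flip_op 1?[k == _]eq_sym //.
  by rewrite [flip _ _ _ *m (_ *m _)]mulmxA flipK // mul1mx.
rewrite flip_sandwich; apply: eq_bigr => a _; apply: eq_bigr => b _.
congr (_ *: _); rewrite mulmxA flip_op // -!mulmxA -flip_opr //.
by rewrite [flip _ _ _ *m (_ *m _)]mulmxA flipK // mul1mx.
Qed.

Lemma flip_flip d i j k l : k != i -> k != j -> l != i -> l != j ->
  flip d i j *m flip d k l = flip d k l *m flip d i j.
Proof.
move=> ki kj li lj; rewrite -[LHS]mulmx1 -[RHS]mul1mx mulmxA !flip_sandwich.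
apply: eq_bigr => a _; apply: eq_bigr => b _; congr (_ *: _).
by rewrite mulmx1 mul1mx mulmxA flip_op // -!mulmxA flip_op.
Qed.

Lemma flipS d i j : flip d.+1 i.+1 j.+1 = tcons 1%:M (flip d i j).
Proof.
rewrite /flip raddf_sum; apply: eq_bigr => a _; rewrite raddf_sum.
by apply: eq_bigr => b _; rewrite /= tconsM mul1mx linearZ.
Qed.

End Swap.

(** * Symmetrization and the double commutant *)

Lemma perm_imsetD1 (T : finType) (t : {perm T}) (A : {set T}) i :
  t @: (A :\ i) = t @: A :\ t i.
Proof.
apply/setP=> l; rewrite -[l](permKV t) in_setD1.
by rewrite !(mem_imset _ _ perm_inj) in_setD1 (inj_eq perm_inj).
Qed.

Lemma linear_mxE (F : fieldType) (V : lmodType F) k (f : 'M[F]_k -> V) X :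
  linear f -> f X = \sum_a \sum_b X a b *: f (delta_mx a b).
Proof.
move=> f_lin; pose fm := GRing.isLinear.Build F 'M[F]_k V *:%R f f_lin.
pose fL : {linear 'M[F]_k -> V} := HB.pack f fm.
suff : fL X = \sum_a \sum_b X a b *: fL (delta_mx a b) by [].
rewrite {1}(matrix_sum_delta X) linear_sum; apply: eq_bigr => a _.
by rewrite linear_sum; apply: eq_bigr => b _; rewrite linearZ.
Qed.

Section Symmetrizer.
Variables (F : numFieldType) (m n d : nat).
Notation N := (m + n)%N.
Notation gl := (gl F m n).
Notation M := 'M[F]_(tdim m n d).
Notation op := (@op F m n d).
Notation flip := (@flip F m n d).

(* The sum of the products x_1^{(i_1)} ... x_k^{(i_k)} over the distinct
   positions i_1, ..., i_k in A. *)
Fixpoint inj_sum (A : {set 'I_d}) (s : seq gl) : M :=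
  if s is x :: s' then \sum_(i in A) op i x *m inj_sum (A :\ i) s' else 1%:M.

Lemma flip_op_tperm (i j k : 'I_d) x : i != j ->
  flip i j *m op k x = op (tperm i j k) x *m flip i j.
Proof.
move=> ij; case: tpermP => [->|->|/eqP ki /eqP kj].
- exact: flip_opl.
- exact: flip_opr.
- exact: flip_op.
Qed.

Lemma flip_inj_sum (i j : 'I_d) A s : i != j ->
  flip i j *m inj_sum A s = inj_sum (tperm i j @: A) s *m flip i j.
Proof.
move=> ij; elim: s A => [|x s IH] A /=; first by rewrite mulmx1 mul1mx.
rewrite big_imset /=; last by move=> ? ? _ _ /perm_inj.
rewrite mulmx_sumr mulmx_suml; apply: eq_bigr => k _.
rewrite mulmxA flip_op_tperm // -!mulmxA IH; congr (_ *m (inj_sum _ _ *m _)).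
exact: perm_imsetD1.
Qed.

(** The second matrix is the reversed word, hence the inverse of the first. The bound k is from
    below, so that these words commute with operators at positions before k. *)
Inductive flip_word (k : nat) : M -> M -> Prop :=
| flip_word1 : flip_word k 1%:M 1%:M
| flip_wordS i R R' : (k <= i)%N -> (i.+1 < d)%N -> flip_word k R R' ->
    flip_word k (flip i i.+1 *m R) (R' *m flip i i.+1).

Lemma flip_word_ge k l R R' : (l <= k)%N -> flip_word k R R' -> flip_word l R R'.
Proof.
move=> lk; elim=> [|i Q Q' ki id _ IH]; first exact: flip_word1.
by apply: flip_wordS => //; apply: leq_trans ki.
Qed.

Lemma flip_word_mul k R R' Q Q' : flip_word k R R' -> flip_word k Q Q' ->
  flip_word k (R *m Q) (Q' *m R').
Proof.
move=> hR hQ; elim: hR => [|i P P' ki id _ IH]; first by rewrite mul1mx mulmx1.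
by rewrite -[_ *m P *m _]mulmxA [Q' *m _]mulmxA; apply: flip_wordS.
Qed.

Lemma ltn_neqS (i : nat) : i != i.+1.
Proof. by rewrite neq_ltn ltnSn. Qed.

Lemma flip_wordK k R R' : flip_word k R R' -> R' *m R = 1%:M.
Proof.
elim=> [|i P P' ki id _ IH]; first by rewrite mul1mx.
rewrite -mulmxA [flip _ _ *m (_ *m _)]mulmxA flipK ?ltn_neqS //; last exact: ltnW.
by rewrite mul1mx.
Qed.

Lemma flip_wordV k R R' : flip_word k R R' -> R *m R' = 1%:M.
Proof. by move/flip_wordK/mulmx1C. Qed.

Lemma flip_word_comm k R R' j x : flip_word k R R' -> (j < k)%N ->
  R *m op j x = op j x *m R /\ R' *m op j x = op j x *m R'.
Proof.
move=> + jk; elim=> [|i P P' ki id _ [IH IH']]; first by rewrite mul1mx mulmx1.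
have [ji ji1] : j != i /\ j != i.+1.
  by rewrite !neq_ltn (leq_trans jk ki) ltnS (leq_trans (ltnW jk) ki).
split; first by rewrite -mulmxA IH mulmxA flip_op // -mulmxA.
by rewrite -mulmxA flip_op // mulmxA IH' -mulmxA.
Qed.

Definition from (k : nat) : {set 'I_d} := [set i : 'I_d | (k <= i)%N].

(** The word is the cycle (i-1, i) ... (k, k+1): it carries position k to i and shifts the positions
    k+1, ..., i down by one, hence [from k.+1] onto [from k :\ i]. *)
Lemma inj_sum_cycle k (i : 'I_d) : (k <= i)%N -> exists C : M * M,
  flip_word k C.1 C.2 /\ forall x s, op i x *m inj_sum (from k :\ i) s =
    C.1 *m (op k x *m inj_sum (from k.+1) s) *m C.2.
Proof.
move=> ki; have [e ie] : exists e, nat_of_ord i = (k + e)%N.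
  by exists (i - k)%N; rewrite subnKC.
elim: e i ie {ki} => [|e IH] i ie.
  exists (1%:M, 1%:M); split=> [|x s]; first exact: flip_word1.
  rewrite /= mul1mx mulmx1; rewrite addn0 in ie; rewrite -ie; congr (_ *m inj_sum _ _).
  by apply/setP=> j; rewrite !inE ie ltn_neqAle eq_sym -(inj_eq val_inj) /= ie.
have jd : (k + e < d)%N by rewrite (leq_trans _ (ltn_ord i)) // ie addnS.
pose j := Ordinal jd; have [//|[C C'] [hC IHC]] := IH j;
  rewrite ![(_, _).1]/= ![(_, _).2]/= in hC IHC.
have ij : nat_of_ord i = j.+1 by rewrite ie addnS.
have ji : j != i by apply/eqP=> e1; have := ltn_neqS j; rewrite -ij -e1 eqxx.
have jd1 : (j.+1 < d)%N by rewrite -ij.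
exists (flip j i *m C, C' *m flip j i); split=> [|x s] /=.
  by rewrite ij; apply: flip_wordS => //; apply: leq_addr.
have -> : flip j i *m C *m (op k x *m inj_sum (from k.+1) s) *m (C' *m flip j i)
  = flip j i *m (C *m (op k x *m inj_sum (from k.+1) s) *m C') *m flip j i.
  by rewrite !mulmxA.
rewrite -IHC.
rewrite !mulmxA flip_op_tperm // tpermL -!mulmxA.
rewrite [flip j i *m (_ *m _)]mulmxA flip_inj_sum // -mulmxA flipK ?mulmx1 //.
congr (_ *m inj_sum _ _); apply/setP=> l; rewrite perm_imsetD1.
rewrite tpermL !in_setD1; congr (_ && _).
rewrite -[l in RHS](tpermK j i) mem_imset; last exact: perm_inj.
by rewrite !inE; case: tpermP => // ->; rewrite ij /= ?leqW ?leq_addr //.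
Qed.

(** Sorting the positions: a cycle brings the first letter to position k, and the words for k + 1
    sort the others without disturbing it. The list has one entry for each permutation of the
    positions from k on, that is (d - k)! entries. *)
Lemma inj_sum_words k : (k <= d)%N -> exists L : seq (M * M),
  [/\ (0 < size L)%N, forall p, p \in L -> flip_word k p.1 p.2 &
   forall s, size s = (d - k)%N ->
     inj_sum (from k) s = \sum_(p <- L) p.1 *m tword d k s *m p.2].
Proof.
move=> kd; have [e] : exists e, (d = k + e)%N by exists (d - k)%N; rewrite subnKC.
elim: e k kd => [|e IH] k kd de.
  exists [:: (1%:M, 1%:M)]; split=> // [p|s].
    by rewrite inE => /eqP ->; apply: flip_word1.
  rewrite {1}de addn0 subnn => /size0nil ->.
  by rewrite big_seq1 /= !mulmx1.
have kd' : (k < d)%N by rewrite de addnS ltnS leq_addr.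
have [|L [L0 Lw LY]] := IH k.+1 kd'; first by rewrite de addSnnS.
have /fin_all_exists[C hC] : forall i : 'I_d, exists C : M * M, (k <= i)%N ->
  flip_word k C.1 C.2 /\ forall x s, op i x *m inj_sum (from k :\ i) s =
    C.1 *m (op k x *m inj_sum (from k.+1) s) *m C.2.
  (* Positions below k receive a dummy pair; the sums run over [from k]. *)
  move=> i; have [/inj_sum_cycle[C hC]|_] := boolP (k <= i)%N; first by exists C.
  by exists (0, 0).
exists [seq ((C i).1 *m p.1, p.2 *m (C i).2) | i <- enum (from k), p <- L].
split.
- rewrite size_allpairs muln_gt0 L0 andbT -cardE; apply/card_gt0P.
  by exists (Ordinal kd'); rewrite inE.
- move=> p /allpairsP[[i q] /= [+ qL ->]].
  rewrite mem_enum inE => ki; apply: flip_word_mul; first by case: (hC i ki).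
  by apply: (@flip_word_ge k.+1) => //; apply: Lw.
case=> [|x s] ss.
  by move/eqP: ss; rewrite eq_sym subn_eq0 leqNgt kd'.
rewrite /= big_allpairs_dep [RHS]big_enum /=.
apply: eq_bigr => i; rewrite inE => ki; rewrite (hC i ki).2 LY; last first.
  by rewrite subnS -ss.
rewrite mulmx_sumr mulmx_sumr mulmx_suml; apply: eq_big_seq => p /Lw pL /=.
have [c1 c2] := flip_word_comm x pL (ltnSn k).
by rewrite !mulmxA -[_ *m op k x *m p.1]mulmxA -c1 !mulmxA.
Qed.

(** The image of the group algebra of S_k, permuting the first k positions when k is at most d. In
    contrast to [flip_word], the bound is from above. *)
Inductive flip_alg (k : nat) : M -> Prop :=
| flip_alg_scalar a : flip_alg k a%:M
| flip_alg_flip i : (i.+1 < k)%N -> flip_alg k (flip i i.+1)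
| flip_algD X Y : flip_alg k X -> flip_alg k Y -> flip_alg k (X + Y)
| flip_algM X Y : flip_alg k X -> flip_alg k Y -> flip_alg k (X *m Y).

Lemma flip_algZ k a X : flip_alg k X -> flip_alg k (a *: X).
Proof. by move=> hX; rewrite -mul_scalar_mx; apply: flip_algM => //; constructor. Qed.

Lemma flip_alg_word R R' : flip_word 0 R R' -> flip_alg d R /\ flip_alg d R'.
Proof.
elim=> [|i P P' _ id _ [hP hP']]; first by split; apply: flip_alg_scalar.
by split; apply: flip_algM => //; apply: flip_alg_flip.
Qed.

Lemma flip_alg_sum (I : eqType) (r : seq I) (P : pred I) k (G : I -> M) :
  (forall i, i \in r -> P i -> flip_alg k (G i)) -> flip_alg k (\sum_(i <- r | P i) G i).
Proof.
move=> hG; rewrite big_seq_cond; apply: (big_ind (flip_alg k)).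
- by rewrite -(raddf0 (@scalar_mx F (tdim m n d))); apply: flip_alg_scalar.
- exact: flip_algD.
- by move=> i /andP[ir Pi]; apply: hG.
Qed.

Section Symm.
Variable L : seq (M * M).
Hypothesis L0 : (0 < size L)%N.
Hypothesis Lw : forall p, p \in L -> flip_word 0 p.1 p.2.
Hypothesis Lsum : forall s, size s = d ->
  inj_sum [set: 'I_d] s = \sum_(p <- L) p.1 *m tword d 0 s *m p.2.

(** By [flip_symm] the values commute with the adjacent flips, and by [symm_comm] the map multiplies
    their commutant by the size of [L]. *)
Definition symm (T : M) : M := \sum_(p <- L) p.1 *m T *m p.2.

Lemma symm_linear : linear symm.
Proof.
move=> a X Y; rewrite /symm scaler_sumr -big_split; apply: eq_bigr => p _ /=.
by rewrite mulmxDr mulmxDl -scalemxAr -scalemxAl.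
Qed.
HB.instance Definition _ := GRing.isLinear.Build F M M *:%R symm symm_linear.

Lemma symm_comm T : (forall i, (i.+1 < d)%N -> flip i i.+1 *m T = T *m flip i i.+1) ->
  symm T = (size L)%:R *: T.
Proof.
move=> hT; have wT k R R' : flip_word k R R' -> R *m T = T *m R.
  elim=> [|i P P' _ id _ IH]; first by rewrite mul1mx mulmx1.
  by rewrite -mulmxA IH !mulmxA hT.
rewrite scaler_nat -[X in _ *+ X]card_ord -sumr_const /symm (big_nth (0, 0)) big_mkord.
apply: eq_bigr => i _; have /Lw pw := mem_nth (0, 0) (ltn_ord i).
by rewrite (wT _ _ _ pw) -mulmxA (flip_wordV pw) mulmx1.
Qed.

(** On a word of d letters, [symm] is the sum over all injective placements, and a flip maps the set
    of all positions to itself. *)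
Lemma flip_symm i T : (i.+1 < d)%N -> flip i i.+1 *m symm T = symm T *m flip i i.+1.
Proof.
move=> id; elim/tword_span: T => [|a X Y hX hY|s ss _].
- by rewrite raddf0 mulmx0 mul0mx.
- by rewrite linearP mulmxDr mulmxDl -scalemxAr -scalemxAl hX hY.
rewrite /symm -Lsum // (@flip_inj_sum (Ordinal (ltnW id)) (Ordinal id)) //.
  congr (inj_sum _ _ *m _); apply/setP=> j; rewrite inE.
  rewrite -[j](tpermK (Ordinal (ltnW id)) (Ordinal id)) mem_imset ?inE //.
  exact: perm_inj.
by rewrite -val_eqE /= ltn_neqS.
Qed.

(* M \otimes M^op acts faithfully on M, so [flip_symm] says that the element
   \sum R \otimes R' is balanced. *)
Lemma symm_balanced i (V : lmodType F) (f : M -> M -> V) : (i.+1 < d)%N ->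
  (forall X, linear (f X)) -> (forall Y, linear (f^~ Y)) ->
  \sum_(p <- L) f (flip i i.+1 *m p.1) p.2 = \sum_(p <- L) f p.1 (p.2 *m flip i i.+1).
Proof.
move=> id fr fl.
have fE X Y : f X Y = \sum_a \sum_b \sum_c \sum_e
    (X a b * Y c e) *: f (delta_mx a b) (delta_mx c e).
  rewrite (linear_mxE X (fl Y)); apply: eq_bigr => a _; apply: eq_bigr => b _.
  rewrite (linear_mxE Y (fr _)) scaler_sumr; apply: eq_bigr => c _.
  by rewrite scaler_sumr; apply: eq_bigr => e _; rewrite scalerA.
under eq_bigr do rewrite fE; under [RHS]eq_bigr do rewrite fE.
rewrite [LHS]exchange_big [RHS]exchange_big /=; apply: eq_bigr => a _.
rewrite [LHS]exchange_big [RHS]exchange_big /=; apply: eq_bigr => b _.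
rewrite [LHS]exchange_big [RHS]exchange_big /=; apply: eq_bigr => c _.
rewrite [LHS]exchange_big [RHS]exchange_big /=; apply: eq_bigr => e _.
rewrite -!scaler_suml; congr (_ *: _).
have /matrixP/(_ a e) := flip_symm (delta_mx b c) id.
rewrite /symm mulmx_sumr mulmx_suml !summxE => h.
have dE (X Y : M) : (X *m delta_mx b c *m Y) a e = X a b * Y c e.
  rewrite mxE (bigD1 c) //= mxE (bigD1 b) //= !mxE !eqxx mulr1 !big1 ?addr0 //.
    move=> j nj; rewrite mxE big1 ?mul0r // => k _.
    by rewrite mxE (negPf nj) andbF mulr0.
  by move=> j nj; rewrite mxE (negPf nj) mulr0.
transitivity (\sum_(p <- L) (flip i i.+1 *m (p.1 *m delta_mx b c *m p.2)) a e).
  by apply: eq_bigr => p _; rewrite !mulmxA dE.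
by rewrite h; apply: eq_bigr => p _; rewrite -mulmxA dE.
Qed.

(** Under left multiplication, [M] is a sum of copies of V^{\otimes d}, one per column. A linear
    endomorphism of [M] that commutes with the flips has its blocks in their commutant, so it
    commutes with left multiplication by w. For the average [av] of a projection onto the span of
    the inverse words this gives |L| w = w av(1) = av(w), and the right side lies in the algebra of
    the flips. *)
Lemma bicommutant w :
  (forall T, (forall i, (i.+1 < d)%N -> flip i i.+1 *m T = T *m flip i i.+1) ->
    w *m T = T *m w) -> flip_alg d w.
Proof.
move=> hw.
pose B : 'M[F]_(size L, tdim m n d * tdim m n d) :=
  \matrix_(k < size L) mxvec (nth (0, 0) L k).2.
(* The pseudo-inverse makes this a projection onto the row space of [B], that is, the span of the
   inverse words, even when these are linearly dependent. *)
pose prB X : M := vec_mx (mxvec X *m pinvmx B *m B).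
have prB_lin : linear prB.
  by move=> a X Y; rewrite /prB !linearP /= !mulmxDl -!scalemxAl linearP.
have prB_id p : p \in L -> prB p.2 = p.2.
  move=> pL; rewrite /prB mulmxKpV ?mxvecK //.
  have il : (index p L < size L)%N by rewrite index_mem.
  rewrite -[p](nth_index (0, 0) pL) -[index p L]/(nat_of_ord (Ordinal il)).
  by rewrite -(rowK (fun k : 'I_(size L) => mxvec (nth (0, 0) L k).2)) row_sub.
have prB_alg X : flip_alg d (prB X).
  rewrite /prB mulmx_sum_row linear_sum; apply: flip_alg_sum => k _ _.
  rewrite linearZ /= rowK mxvecK; apply: flip_algZ.
  by have /Lw/flip_alg_word[] := mem_nth (0, 0) (ltn_ord k).
pose av X := \sum_(p <- L) p.1 *m prB (p.2 *m X).
have av_flip i X : (i.+1 < d)%N -> av (flip i i.+1 *m X) = flip i i.+1 *m av X.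
  move=> id; rewrite /av mulmx_sumr.
  rewrite [RHS](eq_bigr (fun p => flip i i.+1 *m p.1 *m prB (p.2 *m X))) //; last first.
    by move=> p _; rewrite mulmxA.
  rewrite (@symm_balanced i M (fun R R' => R *m prB (R' *m X))) //.
  - by apply: eq_bigr => p _; rewrite mulmxA.
  - by move=> R a Y Z; rewrite mulmxDl -scalemxAl prB_lin mulmxDr -scalemxAr.
  - by move=> Y a R Z; rewrite mulmxDl -scalemxAl.
have av_lin : linear av.
  move=> a X Y; rewrite /av scaler_sumr -big_split; apply: eq_bigr => p _ /=.
  by rewrite mulmxDr -scalemxAr prB_lin mulmxDr -scalemxAr.
have avE X := linear_mxE X av_lin.
have avdE P s j : av (P *m delta_mx s j) = \sum_t P t s *: av (delta_mx t j).
  rewrite avE; apply: eq_bigr => t _; rewrite (bigD1 j) //= big1 ?addr0.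
    congr (_ *: _); rewrite mxE (bigD1 s) //= !mxE !eqxx mulr1 big1 ?addr0 // => k nk.
    by rewrite mxE (negPf nk) mulr0.
  move=> l nl; rewrite mxE big1 ?scale0r // => k _.
  by rewrite mxE (negPf nl) andbF mulr0.
(* The matrix th i j describes u |-> av (u e_j^T) e_i. *)
pose th i j : M := \matrix_(r, s) av (delta_mx s j) r i.
have thE P i j r s : (th i j *m P) r s = av (P *m delta_mx s j) r i.
  by rewrite avdE summxE mxE; apply: eq_bigr => t _; rewrite !mxE mulrC.
have thE' P i j r s : (P *m th i j) r s = (P *m av (delta_mx s j)) r i.
  by rewrite !mxE; apply: eq_bigr => t _; rewrite mxE.
(* The block inherits from [av] that it commutes with the flips, so the hypothesis on w applies to
   it. *)
have th_comm i j : w *m th i j = th i j *m w.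
  apply: hw => k kd; apply/matrixP=> r s.
  by rewrite thE' thE av_flip.
have avw : av w = w *m av 1%:M.
  have avw_lin : linear (fun X => av (w *m X)).
    by move=> a X Y; rewrite mulmxDr -scalemxAr av_lin.
  rewrite -{1}[w]mulmx1 (linear_mxE 1%:M avw_lin) (avE 1%:M) mulmx_sumr.
  apply: eq_bigr => s _; rewrite mulmx_sumr; apply: eq_bigr => j _.
  rewrite -scalemxAr; congr (_ *: _).
  by apply/matrixP=> r i; rewrite -thE -th_comm thE'.
have av1 : av 1%:M = (size L)%:R%:M.
  rewrite /av -[RHS]scalemx1 scaler_nat -[X in _ *+ X]card_ord -sumr_const.
  rewrite (big_nth (0, 0)) big_mkord; apply: eq_bigr => i _; have pL := mem_nth (0, 0) (ltn_ord i).
  by rewrite mulmx1 prB_id // (flip_wordV (Lw pL)).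
have sz0 : (size L)%:R != 0 :> F by rewrite pnatr_eq0 -lt0n.
have -> : w = (size L)%:R^-1 *: av w.
  by rewrite avw av1 mul_mx_scalar scalerA mulVf // scale1r.
apply: flip_algZ; apply: flip_alg_sum => p /Lw/flip_alg_word[pa _] _.
by apply: flip_algM.
Qed.

End Symm.
End Symmetrizer.

(** * The enveloping algebra acting on tensor powers *)

Section MatrixLift.
Variables (F : numFieldType) (g : lieSuperType F).

(* An [algType] is nontrivial, which 'M_D is not when D = 0, as happens for
   m = n = 0. *)
Definition env_mx (D : nat) : (g -> 'M[F]_D) -> env g -> 'M[F]_D :=
  match D with
  | 0 => fun _ _ => 0
  | D'.+1 => fun f => @env_lift F g 'M[F]_D'.+1 f
  end.

Variables (D : nat) (f : g -> 'M[F]_D).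
Hypothesis f_linear : linear f.
Hypothesis f_sbr : forall p q x y, hcomp p x = x -> hcomp q y = y ->
  f x *m f y - (-1) ^+ (p && q) *: (f y *m f x) = f (sbr x y).

Lemma mx0_eq (A B : 'M[F]_0) : A = B.
Proof. by apply/matrixP=> -[]. Qed.

Lemma env_mxE x : env_mx f (env_in x) = f x.
Proof. case: D f f_linear f_sbr => [|D'] h hl hs; [exact: mx0_eq|exact: env_liftE]. Qed.

Lemma env_mx_linear : linear (env_mx f).
Proof.
case: D f f_linear f_sbr => [|D'] h hl hs; last exact: env_lift_linear.
by move=> a u v; apply: mx0_eq.
Qed.

Lemma env_mxM u v : env_mx f (u * v) = env_mx f u *m env_mx f v.
Proof.
case: D f f_linear f_sbr => [|D'] h hl hs; first exact: mx0_eq.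
by have [_] := env_lift_monoid hl hs; apply.
Qed.

Lemma env_mx1 : env_mx f 1 = 1%:M.
Proof.
case: D f f_linear f_sbr => [|D'] h hl hs; first exact: mx0_eq.
by have [] := env_lift_monoid hl hs.
Qed.

End MatrixLift.

(** * The degree filtration of the enveloping algebra *)

Section Degree.
Variables (F : numFieldType) (g : lieSuperType F).
Notation U := (env g).

(* [deg_lt d u]: u is a combination of products of less than d elements of g. *)
Inductive deg_lt : nat -> U -> Prop :=
| deg_lt0 d : deg_lt d 0
| deg_lt_scalar d a : deg_lt d.+1 a%:A
| deg_ltD d u v : deg_lt d u -> deg_lt d v -> deg_lt d (u + v)
| deg_lt_in d x u : deg_lt d u -> deg_lt d.+1 (env_in x * u).

Lemma deg_ltZ d a u : deg_lt d u -> deg_lt d (a *: u).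
Proof.
elim=> {d u} [d|d b|d u v _ IHu _ IHv|d x u _ IH].
- by rewrite scaler0; apply: deg_lt0.
- by rewrite scalerA; apply: deg_lt_scalar.
- by rewrite scalerDr; apply: deg_ltD.
- by rewrite scalerAr; apply: deg_lt_in.
Qed.

Lemma deg_ltB d u v : deg_lt d u -> deg_lt d v -> deg_lt d (u - v).
Proof. by move=> hu hv; rewrite -scaleN1r; apply: deg_ltD => //; apply: deg_ltZ. Qed.

Lemma deg_lt_le d e u : (d <= e)%N -> deg_lt d u -> deg_lt e u.
Proof.
move=> + hu; elim: hu e => {d u} [d|d a|d u v _ IHu _ IHv|d x u _ IH] e de.
- exact: deg_lt0.
- by case: e de => // e _; apply: deg_lt_scalar.
- by apply: deg_ltD; [apply: IHu|apply: IHv].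
- by case: e de => // e de; apply: deg_lt_in; apply: IH.
Qed.

Lemma deg_ltM d e u v : deg_lt d u -> deg_lt e.+1 v -> deg_lt (d + e) (u * v).
Proof.
move=> + hv; elim=> {d u} [d|d a|d u u' _ IHu _ IHu'|d x u _ IH].
- by rewrite mul0r; apply: deg_lt0.
- rewrite -scalerAl mul1r; apply: deg_ltZ; apply: deg_lt_le hv.
  by rewrite addSn ltnS leq_addl.
- by rewrite mulrDl; apply: deg_ltD.
- by rewrite -mulrA addSn; apply: deg_lt_in.
Qed.

Lemma deg_lt_env_in d x : deg_lt d.+2 (env_in x : U).
Proof. by rewrite -[env_in x]mulr1 -[1]scale1r; apply/deg_lt_in/deg_lt_scalar. Qed.

Lemma deg_lt_exists u : exists d, deg_lt d u.
Proof.
elim/env_ind: u; elim=> [x|||u [d hu] v [e hv]|a u [d hu]|u [d hu] v [e hv]].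
- by exists 2%N; apply: deg_lt_env_in.
- by exists 0%N; apply: deg_lt0.
- by exists 1%N; rewrite -[env_pi _]/(1 : U) -[1]scale1r; apply: deg_lt_scalar.
- exists (maxn d e); rewrite -env_piD -/(env_pi u + env_pi v).
  by apply: deg_ltD; [apply: deg_lt_le hu|apply: deg_lt_le hv];
    rewrite ?leq_maxl ?leq_maxr.
- by exists d; rewrite -env_piZ -/(a *: env_pi u); apply: deg_ltZ.
- exists (d + e)%N; rewrite -env_piM -/(env_pi u * env_pi v).
  by apply: deg_ltM => //; apply: deg_lt_le hv.
Qed.

Lemma env_gen_ind (P : U -> Prop) : P 1 ->
  (forall a u v, P u -> P v -> P (a *: u + v)) ->
  (forall p x u, hcomp p x = x -> P u -> P (env_in x * u)) -> forall u, P u.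
Proof.
move=> P1 PL PM u; have [d] := deg_lt_exists u.
have P0 : P 0 by rewrite -[0](addNr 1) -scaleN1r; apply: PL.
elim=> {d u} [d|d a|d u v _ hu _ hv|d x u _ hu] //.
- by rewrite -[_%:A]addr0; apply: PL.
- by rewrite -[u]scale1r; apply: PL.
rewrite -(hcompD x) raddfD mulrDl -[X in X + _]scale1r.
by apply: PL; [apply: (PM false)|apply: (PM true)] => //; rewrite hcompK eqxx.
Qed.

End Degree.

(** * Actions on subsets of the tensor factors and their inclusion-exclusion *)

Section Coproduct.
Variables (F : numFieldType) (m n d : nat).
Notation gl := (gl F m n).
Notation U := (env gl).
Notation M := 'M[F]_(tdim m n d).
Notation op := (@op F m n d).

Definition opsum (A : {set 'I_d}) (x : gl) : M := \sum_(i in A) op i x.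

Lemma opsum_linear A : linear (opsum A).
Proof.
move=> a x y; rewrite /opsum scaler_sumr -big_split; apply: eq_bigr => i _.
by rewrite linearP.
Qed.

Lemma opsum_sbr A p q x y : hcomp p x = x -> hcomp q y = y ->
  opsum A x *m opsum A y - (-1) ^+ (p && q) *: (opsum A y *m opsum A x) =
  opsum A (sbr x y).
Proof.
move=> hx hy; rewrite /opsum !mulmx_suml scaler_sumr.
under eq_bigr do rewrite mulmx_sumr.
under [X in _ - X]eq_bigr do rewrite mulmx_sumr scaler_sumr.
rewrite [X in _ - X]exchange_big -sumrB; apply: eq_bigr => i iA.
rewrite -sumrB (bigD1 i) //= [X in _ + X]big1 ?addr0.
  by rewrite !op_mul -linearZ -linearB -(gl_sbr_homE hx hy).
move=> j /andP[_ ji]; rewrite (op_comm _ hx hy) ?subrr //.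
by rewrite eq_sym.
Qed.

(** The representation on V^{\otimes d} in which the factors outside [A] are acted on trivially, up
    to the sign rule. *)
Definition rho A : U -> M := env_mx (opsum A).

Lemma rho_in A x : rho A (env_in x) = opsum A x.
Proof. exact: env_mxE (opsum_linear A) (@opsum_sbr A) x. Qed.
Lemma rho_linear A : linear (rho A).
Proof. exact: env_mx_linear (opsum_linear A) (@opsum_sbr A). Qed.
Lemma rhoM A u v : rho A (u * v) = rho A u *m rho A v.
Proof. exact: env_mxM (opsum_linear A) (@opsum_sbr A) u v. Qed.
Lemma rho1 A : rho A 1 = 1%:M.
Proof. exact: env_mx1 (opsum_linear A) (@opsum_sbr A). Qed.
HB.instance Definition _ A := GRing.isLinear.Build F U M *:%R (rho A) (rho_linear A).

Lemma parK_rho A u : parK F m n d *m rho A u = rho A (env_sigma u) *m parK F m n d.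
Proof.
elim/env_gen_ind: u => [|a u v hu hv|p x u hx hu].
- by rewrite rmorph1 rho1 mul1mx mulmx1.
- by rewrite !linearP /= hu hv mulmxDl -scalemxAl.
rewrite rmorphM /= (env_sigma_in hx) -scalerAl linearZ /= !rhoM !rho_in.
rewrite -scalemxAl -[in RHS]mulmxA -hu !mulmxA [in RHS]scalemxAl; congr (_ *m _).
rewrite /opsum mulmx_sumr mulmx_suml scaler_sumr; apply: eq_bigr => i _.
exact: parK_op.
Qed.

Lemma sigma_iterL p a (u v : U) : iter p (@env_sigma F gl) (a *: u + v) =
  a *: iter p (@env_sigma F gl) u + iter p (@env_sigma F gl) v.
Proof. by elim: p => //= p ->; rewrite linearP. Qed.

Lemma sigma_iterM p (u v : U) : iter p (@env_sigma F gl) (u * v) =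
  iter p (@env_sigma F gl) u * iter p (@env_sigma F gl) v.
Proof. by elim: p => //= p ->; rewrite rmorphM. Qed.

Lemma sigma_iter1 p : iter p (@env_sigma F gl) 1 = 1.
Proof. by elim: p => //= p ->; rewrite rmorph1. Qed.

Lemma op_rho (A : {set 'I_d}) (j : 'I_d) p x (u : U) : hcomp p x = x -> j \notin A ->
  op j x *m rho A u = rho A (iter p (@env_sigma F gl) u) *m op j x.
Proof.
move=> hx jA; elim/env_gen_ind: u => [|a u v hu hv|q y u hy hu].
- by rewrite sigma_iter1 rho1 mul1mx mulmx1.
- rewrite sigma_iterL.
  by rewrite !linearP /= hu hv mulmxDl -scalemxAl.
have -> : iter p (@env_sigma F gl) (env_in y * u) =
    (-1) ^+ (p && q) *: (env_in y * iter p (@env_sigma F gl) u).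
  case: (p) => /=; last by rewrite scale1r.
  by rewrite rmorphM /= (env_sigma_in hy) -scalerAl.
rewrite linearZ /= !rhoM !rho_in -scalemxAl -[in RHS]mulmxA -hu !mulmxA.
rewrite [in RHS]scalemxAl; congr (_ *m _).
rewrite /opsum mulmx_sumr mulmx_suml scaler_sumr; apply: eq_bigr => i iA.
by apply: op_comm => //; apply: contraNneq jA => /val_inj ->.
Qed.

(** The action of x on all factors splits: on the factors in [A] centrality of z applies, and on the
    others x supercommutes with everything that z does, because the positions differ. *)
Lemma rho_central A p x (z : U) : hcomp p x = x -> supercenter z ->
  opsum [set: 'I_d] x *m rho A z = rho A (iter p (@env_sigma F gl) z) *m opsum [set: 'I_d] x.
Proof.
move=> hx hz.
have -> : opsum [set: 'I_d] x = opsum A x + opsum (~: A) x.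
  rewrite /opsum (bigID (mem A)) /=; congr (_ + _); apply: eq_bigl => i.
    by rewrite inE.
  by rewrite !inE.
rewrite mulmxDl mulmxDr; congr (_ + _).
  rewrite -rho_in -!rhoM; congr (rho _ _).
  by apply/eqP; rewrite -subr_eq0; apply/eqP; apply: hz.
rewrite /opsum mulmx_sumr mulmx_suml; apply: eq_bigr => i; rewrite inE => iA.
exact: op_rho.
Qed.

(* The part of u that acts on every tensor factor in A. *)
Definition tau (A : {set 'I_d}) (u : U) : M :=
  \sum_(S : {set 'I_d} | S \subset A) (-1) ^+ #|A :\: S| *: rho S u.

Lemma tau_linear A : linear (tau A).
Proof.
move=> a u v; rewrite /tau scaler_sumr -big_split; apply: eq_bigr => S _ /=.
by rewrite linearP /= scalerDr !scalerA mulrC.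
Qed.
HB.instance Definition _ A := GRing.isLinear.Build F U M *:%R (tau A) (tau_linear A).

Lemma tau_central A p x (z : U) : hcomp p x = x -> supercenter z ->
  opsum [set: 'I_d] x *m tau A z = tau A (iter p (@env_sigma F gl) z) *m opsum [set: 'I_d] x.
Proof.
move=> hx hz; rewrite /tau mulmx_sumr mulmx_suml; apply: eq_bigr => S _.
by rewrite -scalemxAr (rho_central _ hx hz) -scalemxAl.
Qed.

Lemma parK_tau A u : parK F m n d *m tau A u = tau A (env_sigma u) *m parK F m n d.
Proof.
rewrite /tau mulmx_sumr mulmx_suml; apply: eq_bigr => S _.
by rewrite -scalemxAr parK_rho -scalemxAl.
Qed.

Lemma tau_split (A : {set 'I_d}) i u : i \in A ->
  \sum_(S : {set 'I_d} | (S \subset A) && (i \in S)) (-1) ^+ #|A :\: S| *: rho S u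
  = tau A u + tau (A :\ i) u.
Proof.
move=> iA; rewrite {1}/tau [in RHS](bigID (fun S : {set 'I_d} => i \in S)) /=.
rewrite -addrA [X in _ = _ + X](_ : _ = 0) ?addr0 //.
rewrite /tau (eq_bigl (fun S : {set 'I_d} => S \subset A :\ i)); last first.
  by move=> S; rewrite subsetD1.
rewrite -big_split big1 //= => S; rewrite subsetD1 => /andP[_ iS].
rewrite -scalerDl (_ : A :\: S = i |: ((A :\ i) :\: S)); last first.
  by apply/setP=> j; rewrite !inE; case: (j =P i) => [->|]; rewrite ?iA ?iS.
rewrite cardsU1 !inE eqxx andbF /= add1n exprS mulN1r addNr scale0r //.
Qed.

(** The Leibniz rule: x acts at one position i, and u must then cover all of [A], or all of [A] but
    i. *)
Lemma tau_in A x u :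
  tau A (env_in x * u) = \sum_(i in A) op i x *m (tau A u + tau (A :\ i) u).
Proof.
under [RHS]eq_bigr => i iA do rewrite -(tau_split u iA) mulmx_sumr.
rewrite (exchange_big_dep (fun S : {set 'I_d} => S \subset A)) /=; last first.
  by move=> i S _ /andP[].
apply: eq_bigr => S SA; rewrite rhoM rho_in /opsum mulmx_suml scaler_sumr.
apply: eq_big => [i|i _]; last by rewrite -scalemxAr.
by rewrite SA /=; case iS: (i \in S); rewrite ?andbF // (subsetP SA).
Qed.

Lemma tau_scalar A a : tau A a%:A = (if A == set0 then a else 0)%:M.
Proof.
have rhoZ S : rho S a%:A = a%:M by rewrite linearZ /= rho1 scalemx1.
case: ifPn => [/eqP ->|/set0Pn[i iA]].
  rewrite /tau (big_pred1 set0) => [|S]; last by rewrite subset0.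
  by rewrite setD0 cards0 scale1r rhoZ.
have h := tau_split a%:A iA.
(* A scalar acts alike for every S, so adjoining i to the subsets of [A :\ i] changes nothing.
   Comparison with [tau_split] leaves 0 for [A]. *)
have h1 : tau (A :\ i) a%:A = \sum_(S : {set 'I_d} | (S \subset A) && (i \in S))
    (-1) ^+ #|A :\: S| *: rho S a%:A.
  rewrite (reindex_onto (fun S => i |: S) (fun S => S :\ i)) /=; last first.
    by move=> S /andP[_ iS]; rewrite setD1K.
  rewrite /tau; apply: eq_big => S.
    have -> : ((i |: S) :\ i == S) = (i \notin S).
      by apply/eqP/idP => [<-|/setU1K //]; rewrite !inE eqxx.
    by rewrite !inE eqxx andbT subUset sub1set iA subsetD1.
  move=> _; rewrite !rhoZ; congr (_ ^+ _ *: _); congr #|pred_of_set _|.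
  by apply/setP=> j; rewrite !inE negb_or; case: (j == i); rewrite ?andbF ?andbT.
by rewrite raddf0; apply: (addIr (tau (A :\ i) a%:A)); rewrite -h h1 add0r.
Qed.

Definition uword (s : seq gl) : U := foldr (fun x u => env_in x * u) 1 s.

Lemma uword_deg s : deg_lt (size s).+1 (uword s).
Proof.
elim: s => [|x s IH] /=; first by rewrite -[1]scale1r; apply: deg_lt_scalar.
exact: deg_lt_in.
Qed.

(** Fewer letters than positions cannot cover [A]. *)
Lemma tau_deg_lt e (A : {set 'I_d}) (u : U) : deg_lt e u -> (e <= #|A|)%N -> tau A u = 0.
Proof.
move=> hu; elim: hu A => {e u} [e|e a|e u v _ IHu _ IHv|e x u _ IH] A eA.
- exact: raddf0.
- by rewrite tau_scalar; case: eqP eA => [->|_]; rewrite ?cards0 // raddf0.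
- by rewrite raddfD /= IHu // IHv // addr0.
rewrite tau_in big1 // => i iA; rewrite !IH ?addr0 ?mulmx0 //; last exact: ltnW.
by rewrite (cardsD1 i A) iA in eA.
Qed.

(** With as many letters as positions, covering [A] forces the letters to sit at distinct
    positions. *)
Lemma tau_uword (A : {set 'I_d}) s : size s = #|A| -> tau A (uword s) = inj_sum A s.
Proof.
elim: s A => [|x s IH] A /= sA.
  rewrite -[1]scale1r tau_scalar; move/esym/eqP: sA.
  by rewrite cards_eq0 => ->.
rewrite tau_in; apply: eq_bigr => i iA.
have -> : tau A (uword s) = 0 by apply: (tau_deg_lt (uword_deg s)); rewrite sA.
by rewrite add0r IH //; move: sA; rewrite (cardsD1 i A) iA => -[].
Qed.

End Coproduct.

Lemma tword_parJ (F : numFieldType) m n d :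
  tword d 0 (nseq d (parJ F m n)) = parK F m n d.
Proof.
elim: d => [|d IH] //=; rewrite tword_tcons IH -[\sum_p _]/(op d.+1 0 (parJ F m n)).
by rewrite (op0_hom _ (parJ_even F m n)) tconsM mulmx1 mul1mx.
Qed.

(** * Symmetrized tensors as polynomials in the action of gl_{m|n} *)

Section QuasiShuffle.
Variables (F : numFieldType) (m n d : nat).
Notation gl := (gl F m n).
Notation M := 'M[F]_(tdim m n d).
Notation op := (@op F m n d).
Notation opsum := (@opsum F m n d).
Notation inj_sum := (@inj_sum F m n d).

Variable B : gl -> Prop.
Hypothesis B_hom : forall x, B x -> exists p, hcomp p x = x.
Hypothesis B_mul : forall x y, B x -> B y -> B (x *m y).

(** Families indexed by all sets [A], with the same coefficients for each, because the recursion on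
    words removes a position from [A]. *)
Inductive inj_span (k : nat) : ({set 'I_d} -> M) -> Prop :=
| inj_span_word s f : size s = k -> (forall x, x \in s -> B x) ->
    (forall A, f A = inj_sum A s) -> inj_span k f
| inj_span0 f : (forall A, f A = 0) -> inj_span k f
| inj_spanL a f1 f2 f : inj_span k f1 -> inj_span k f2 ->
    (forall A, f A = a *: f1 A + f2 A) -> inj_span k f.

Lemma inj_span_cons k x f (f' : {set 'I_d} -> M) : B x -> inj_span k f ->
  (forall A, f' A = \sum_(i in A) op i x *m f (A :\ i)) -> inj_span k.+1 f'.
Proof.
move=> Bx hf; elim: hf f' => {f} [s f ss Bs fE|f fE|a f1 f2 f _ IH1 _ IH2 fE] f' f'E.
- apply: (@inj_span_word _ (x :: s)) => [|y|A]; first by rewrite /= ss.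
    by rewrite inE => /predU1P[->|/Bs].
  by rewrite f'E; apply: eq_bigr => i _; rewrite fE.
- by apply: inj_span0 => A; rewrite f'E big1 // => i _; rewrite fE mulmx0.
apply: (@inj_spanL _ a) (IH1 _ (fun=> erefl)) (IH2 _ (fun=> erefl)) _ => A.
rewrite f'E scaler_sumr -big_split; apply: eq_bigr => i _ /=.
by rewrite fE mulmxDr scalemxAr.
Qed.

(** The difference collects the terms where y meets a letter of [s] at the same position. If it
    meets the first letter x, the two merge into [y *m x]; otherwise y passes x with a sign and the
    induction takes over. No term gains a letter. *)
Lemma quasi_shuffle y s (f : {set 'I_d} -> M) : B y -> (forall x, x \in s -> B x) ->
  (forall A, f A = opsum A y *m inj_sum A s - inj_sum A (y :: s)) ->
  inj_span (size s) f.
Proof.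
move=> By; elim: s f => [|x s IH] f Bs fE.
  apply: inj_span0 => A; rewrite fE /= mulmx1 /opsum.
  by rewrite -sumrB big1 // => i _; rewrite mulmx1 subrr.
have Bx : B x by apply: Bs; rewrite inE eqxx.
have Bs' z : z \in s -> B z by move=> zs; apply: Bs; rewrite inE zs orbT.
have [p hy] := B_hom By; have [q hx] := B_hom Bx.
pose g (A : {set 'I_d}) := opsum A y *m inj_sum A s - inj_sum A (y :: s).
pose h (A : {set 'I_d}) : M := \sum_(k in A) op k x *m g (A :\ k).
have hS : inj_span (size s).+1 h.
  exact: (inj_span_cons Bx (IH g Bs' (fun=> erefl)) (fun=> erefl)).
have hT : inj_span (size s).+1 (inj_sum^~ (y *m x :: s)).
  apply: (@inj_span_word _ (y *m x :: s)) => // z.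
  by rewrite inE => /predU1P[->|/Bs' //]; apply: B_mul.
apply: (inj_spanL hS hT (a := (-1) ^+ (p && q))).
move=> A; rewrite fE /h scaler_sumr -big_split /=.
have -> : \sum_(i in A) op i y *m (\sum_(k in A :\ i) op k x *m inj_sum (A :\ i :\ k) s)
    = (-1) ^+ (p && q) *: \sum_(k in A) op k x *m inj_sum (A :\ k) (y :: s).
  rewrite /= scaler_sumr.
  under eq_bigr do rewrite mulmx_sumr; under [RHS]eq_bigr do rewrite mulmx_sumr scaler_sumr.
  rewrite (exchange_big_dep (mem A)) /=; last by move=> i k _; rewrite inE => /andP[].
  apply: eq_bigr => k kA; apply: eq_big => [i|i].
    by rewrite !inE kA andbT eq_sym andbC.
  rewrite !inE kA andbT eq_sym => /andP[iA ki]; rewrite mulmxA (op_comm _ hy hx) //.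
  by rewrite -scalemxAl mulmxA !setDDl [[set i] :|: _]finset.setUC.
rewrite mulmx_sumr scaler_sumr -sumrB; apply: eq_bigr => k kA.
rewrite /g mulmxBr scalerBr addrAC; congr (_ - _).
rewrite {1}/opsum (bigD1 k) //= mulmxDl mulmxA op_mul addrC; congr (_ + _).
rewrite mulmxA mulmxA scalemxAl; congr (_ *m _).
rewrite mulmx_suml /opsum mulmx_sumr scaler_sumr; apply: eq_big => [i|i].
  by rewrite !inE andbC.
by case/andP=> _ ik; rewrite (op_comm _ hy hx).
Qed.

(** By [quasi_shuffle], the sum for [y :: s] is the product of the action of y and the sum for [s],
    up to words of the length of [s]. Recursively, all these sums are polynomials in the action. *)
Lemma inj_sum_comm w s : (forall x, B x ->
    opsum [set: 'I_d] x *m w = w *m opsum [set: 'I_d] x) ->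
  (forall x, x \in s -> B x) -> inj_sum [set: 'I_d] s *m w = w *m inj_sum [set: 'I_d] s.
Proof.
move=> hw; have [k] := ubnP (size s); elim: k s => // k IH [|y s].
  by rewrite /= mulmx1 mul1mx.
rewrite /= ltnS => sk Bs; rewrite -/(inj_sum _ (y :: s)).
have By : B y by apply: Bs; rewrite inE eqxx.
have Bs' z : z \in s -> B z by move=> zs; apply: Bs; rewrite inE zs orbT.
have span_comm f : inj_span (size s) f -> f [set: 'I_d] *m w = w *m f [set: 'I_d].
  elim=> {f} [t f st Bt fE|f fE|a f1 f2 f _ h1 _ h2 fE].
  - by rewrite fE IH ?st.
  - by rewrite fE mul0mx mulmx0.
  - by rewrite fE mulmxDl mulmxDr -scalemxAl -scalemxAr h1 h2.
have := span_comm _ (quasi_shuffle By Bs' (fun=> erefl)).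
have e : opsum [set: 'I_d] y *m inj_sum [set: 'I_d] s *m w =
         w *m (opsum [set: 'I_d] y *m inj_sum [set: 'I_d] s).
  by rewrite -mulmxA IH // mulmxA hw // mulmxA.
by rewrite mulmxBl mulmxBr e => /addrI/oppr_inj.
Qed.

End QuasiShuffle.

(** * Invariants lie in the algebra of the flips *)

Section Invariants.
Variables (F : numFieldType) (m n d : nat).
Notation gl := (gl F m n).
Notation M := 'M[F]_(tdim m n d).
Notation opsum := (@opsum F m n d).
Variable L : seq (M * M).
Hypothesis L0 : (0 < size L)%N.
Hypothesis Lw : forall p, p \in L -> flip_word 0 p.1 p.2.
Hypothesis Lsum : forall s, size s = d ->
  inj_sum [set: 'I_d] s = \sum_(p <- L) p.1 *m tword d 0 s *m p.2.

(* The even elements of gl already force an invariant to be even, since they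
   generate the parity operator of the tensor power. *)
Lemma invariant_flip_alg w : (forall p x, hcomp p x = x ->
    opsum [set: 'I_d] x *m w =
    parKX F m n d p *m w *m parKX F m n d p *m opsum [set: 'I_d] x) ->
  flip_alg d w.
Proof.
move=> hw; have sz0 : (size L)%:R != 0 :> F by rewrite pnatr_eq0 -lt0n.
have wK : parK F m n d *m w = w *m parK F m n d.
  (* With every letter equal to the even element [parJ], the sum is the size of [L] times [parK],
     since [parK] commutes with the flips. *)
  have : inj_sum [set: 'I_d] (nseq d (parJ F m n)) *m w =
         w *m inj_sum [set: 'I_d] (nseq d (parJ F m n)).
    apply: (@inj_sum_comm F m n d (fun x => hcomp false x = x)).
    - by move=> x hx; exists false.
    - by move=> x y; apply: hcomp_mul.
    - by move=> x /hw ->; rewrite /= mul1mx mulmx1.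
    - by move=> x /nseqP[-> _]; apply: parJ_even.
  rewrite Lsum ?size_nseq // tword_parJ -/(symm L (parK F m n d)).
  rewrite (symm_comm Lw); last by move=> i _; apply: flip_parK.
  by rewrite -scalemxAl -scalemxAr => /(scalerI sz0).
have hw' x : (exists p, hcomp p x = x) ->
    opsum [set: 'I_d] x *m w = w *m opsum [set: 'I_d] x.
  case=> p /hw ->; case: p => /=; last by rewrite mul1mx mulmx1.
  by rewrite wK -[w *m _ *m _]mulmxA parKK mulmx1.
apply: (bicommutant L0 Lw Lsum) => T hT.
(* A multiple of T is its symmetrization, thus a combination of sums that [inj_sum_comm] handles. *)
apply: (scalerI sz0); rewrite scalemxAr scalemxAl -(symm_comm Lw hT).
elim/tword_span: (T) => [|a X Y hX hY|s ss hs].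
- by rewrite raddf0 mulmx0 mul0mx.
- by rewrite linearP mulmxDr mulmxDl -scalemxAr -scalemxAl hX hY.
rewrite /symm -Lsum //; symmetry.
apply: (@inj_sum_comm F m n d (fun x => exists p, hcomp p x = x)) => //.
by move=> x y [p hx] [q hy]; exists (p (+) q); apply: hcomp_mul.
Qed.

Lemma tau_central_flip_alg (z : env gl) : supercenter z ->
  flip_alg d (tau [set: 'I_d] z).
Proof.
move=> hz; apply: invariant_flip_alg => p x hx; rewrite (tau_central _ hx hz).
congr (_ *m _); case: p {hx} => /=; last by rewrite mul1mx mulmx1.
by rewrite parK_tau -mulmxA parKK mulmx1.
Qed.

End Invariants.

(** * From tensors to the enveloping algebra *)

Arguments op : simpl never.

Section Contract.
Variables (F : numFieldType) (m n : nat).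
Notation N := (m + n)%N.
Notation gl := (gl F m n).
Notation U := (env gl).
Notation M d := 'M[F]_(tdim m n d).
Notation op := (@op F m n).
Notation flip := (@flip F m n).
Notation glE := (@glE F m n).
Notation E := (@E F m n).
Notation parKX d := (@parKX F m n d).
Notation flip_alg d := (@flip_alg F m n d).

(* The linear map End(V)^{\otimes d} -> U(gl) sending x_1^{(1)} ... x_d^{(d)} to
   x_1 ... x_d. *)
Fixpoint tpi d : M d -> U :=
  match d with
  | 0 => fun T => (T ord0 ord0)%:A
  | d'.+1 => fun T => \sum_a \sum_b
      E a b * tpi (parKX d' (par a (+) par b) *m tblock a b T)
  end.

Arguments tpi : simpl never.

Lemma tpiS d (T : M d.+1) : tpi T = \sum_a \sum_b
  E a b * tpi (parKX d (par a (+) par b) *m tblock a b T).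
Proof. by []. Qed.

Lemma tpi_linear d : linear (@tpi d).
Proof.
elim: d => [|d IH] c X Y.
  by rewrite /tpi !mxE scalerDl scalerA.
rewrite !tpiS scaler_sumr -big_split; apply: eq_bigr => a _ /=.
rewrite scaler_sumr -big_split; apply: eq_bigr => b _ /=.
by rewrite !linearP /= IH mulrDr scalerAr.
Qed.
HB.instance Definition _ d := GRing.isLinear.Build F (M d) U *:%R (@tpi d) (@tpi_linear d).

Lemma tpi_cons d (x : gl) Y : tpi (op d.+1 0 x *m tcons 1%:M Y) = env_in x * tpi Y.
Proof.
elim/glhom_ind: x => [x y hx hy|p x hx].
  by rewrite !raddfD /= mulmxDl raddfD /= hx hy mulrDl.
rewrite (op0_hom _ hx) tconsM mulmx1 tpiS {2}(gl_sum x) raddf_sum mulr_suml.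
apply: eq_bigr => a _; rewrite raddf_sum mulr_suml.
apply: eq_bigr => b _; rewrite /= tblockE [in RHS]linearZ /= -[in RHS]scalerAl.
have [->|xab] := eqVneq (x a b) 0; first by rewrite !scale0r mulmx0 raddf0 mulr0.
rewrite (hcomp_par hx xab) -scalemxAr linearZ /= mulmxA parKX_mul addbb mul1mx.
by rewrite scalerAr.
Qed.

Lemma tpi_tword d s : size s = d -> tpi (tword d 0 s) = uword s.
Proof.
elim: s d => [|x s IH] [|d] //= => [_|[sd]]; first by rewrite /tpi mxE scale1r.
by rewrite tword_tcons tpi_cons IH.
Qed.

Lemma flip_tword d i j k s : (i < k)%N -> (j < k)%N ->
  flip d i j *m tword d k s = tword d k s *m flip d i j.
Proof.
elim: s k => [|x s IH] k ik jk /=; first by rewrite mulmx1 mul1mx.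
rewrite mulmxA flip_op; [|by rewrite gtn_eqF|by rewrite gtn_eqF].
by rewrite -!mulmxA IH // ltnW.
Qed.

(** Conjugation by the flip exchanges two adjacent letters of a word with the Koszul sign; in the
    enveloping algebra the error is a bracket, which is one letter shorter. *)
Lemma tpi_flip d i T : (i.+1 < d)%N ->
  deg_lt d (tpi (flip d i i.+1 *m T *m flip d i i.+1) - tpi T).
Proof.
move=> id; elim/tword_span: T => [|a X Y hX hY|s ss hs].
- by rewrite mulmx0 mul0mx subrr; apply: deg_lt0.
- rewrite mulmxDr mulmxDl -scalemxAr -scalemxAl.
  rewrite ![tpi (_ + _)]linearP /= opprD addrACA -scalerBr.
  by apply: deg_ltD => //; apply: deg_ltZ.
elim: d i id s ss hs => [|d IH] [|i] // id [//|x s] /= [ss] hs.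
  case: d s ss hs {IH} id => // d [//|y s] /= [ss] hs _.
  have [p hx] : exists p, hcomp p x = x by apply: hs; rewrite inE eqxx.
  have [q hy] : exists q, hcomp q y = y by apply: hs; rewrite !inE eqxx orbT.
  set Z := tword d.+2 2 s.
  have ZE : Z = tcons 1%:M (tcons 1%:M (tword d 0 s)) by rewrite /Z !tword_tcons.
  have -> : flip d.+2 0 1 *m (op d.+2 0 x *m (op d.+2 1 y *m Z)) *m flip d.+2 0 1 =
      (-1) ^+ (p && q) *: (op d.+2 0 y *m (op d.+2 1 x *m Z)).
    rewrite !mulmxA flip_opl // -[_ *m flip _ _ _ *m _]mulmxA flip_opr //.
    have flipZ : flip d.+2 0 1 *m Z = Z *m flip d.+2 0 1 by apply: flip_tword.
    rewrite -!mulmxA [flip _ _ _ *m (Z *m _)]mulmxA flipZ.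
    rewrite -mulmxA flipK // mulmx1 mulmxA (op_comm _ hx hy) //.
    by rewrite -scalemxAl -mulmxA.
  have e2 (a b : gl) : tpi (op d.+2 0 a *m (op d.+2 1 b *m Z)) =
      env_in a * (env_in b * tpi (tword d 0 s)).
    by rewrite ZE -tpi_cons -tpi_cons -[op _ 1 b]/(tcons 1%:M (op d.+1 0 b)) tconsM mul1mx.
  rewrite linearZ /= !e2 tpi_tword // -opprB !mulrA scalerAl -mulrBl.
  rewrite (env_in_sbr hx hy) -scaleN1r; apply: deg_ltZ; apply: deg_lt_in.
  by apply: deg_lt_le (uword_deg s); rewrite ss.
rewrite tword_tcons flipS.
have -> : tcons 1%:M (flip d i i.+1) *m
    (op d.+1 0 x *m tcons 1%:M (tword d 0 s)) *m tcons 1%:M (flip d i i.+1) =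
    op d.+1 0 x *m tcons 1%:M (flip d i i.+1 *m tword d 0 s *m flip d i i.+1).
  rewrite !mulmxA -flipS flip_op // flipS -!mulmxA !tconsM !mul1mx.
  by rewrite !mulmxA.
rewrite !tpi_cons -mulrBr; apply: deg_lt_in; apply: IH => // y ys.
by apply: hs; rewrite inE ys orbT.
Qed.

Lemma deg_lt0_eq (u : U) : deg_lt 0 u -> u = 0.
Proof.
move: {-2}0%N (erefl 0%N) => e e0 hu; elim: hu e0 => // {e u} e u v _ hu _ hv e0.
by rewrite hu // hv // addr0.
Qed.

Lemma tpi_lead d (u : U) : deg_lt d.+1 u -> exists T : M d, deg_lt d (u - tpi T).
Proof.
move: {-2}(d.+1) (erefl d.+1) => e ed hu.
elim: hu d ed => {e u} [e|e a|e u v _ IHu _ IHv|e x u hu IH] d ed.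
- by exists 0; rewrite raddf0 subr0; apply: deg_lt0.
- case: d {ed} => [|d]; last by exists 0; rewrite raddf0 subr0; apply: deg_lt_scalar.
  have t1 : tpi (1%:M : M 0) = 1 by rewrite /tpi mxE scale1r.
  exists (a *: 1%:M : M 0); have -> : tpi (a *: 1%:M : M 0) = a%:A.
    by rewrite -t1; apply: (linearZ_LR (@tpi 0)).
  by rewrite subrr; apply: deg_lt0.
- have [T hT] := IHu d ed; have [T' hT'] := IHv d ed.
  by exists (T + T'); rewrite raddfD /= opprD addrACA; apply: deg_ltD.
case: ed => ed; subst e; case: d hu IH => [|d] hu IH.
  by exists 0; rewrite raddf0 subr0 (deg_lt0_eq hu) mulr0; apply: deg_lt0.
have [T hT] := IH d erefl; exists (op d.+1 0 x *m tcons 1%:M T).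
by rewrite tpi_cons -mulrBr; apply: deg_lt_in.
Qed.

(** Invariance under conjugation, applied to a flip times T, becomes a trace property, which passes
    to sums and products of flips. *)
Lemma tpi_flip_alg d T X : flip_alg d d X -> deg_lt d (tpi (T *m X) - tpi (X *m T)).
Proof.
move=> hX; elim: hX T => {X} [a|i id|X Y _ IHX _ IHY|X Y _ IHX _ IHY] T.
- by rewrite mul_mx_scalar mul_scalar_mx subrr; apply: deg_lt0.
- have := tpi_flip (flip d i i.+1 *m T) id.
  by rewrite mulmxA flipK ?mul1mx ?ltn_neqS // ltnW.
- rewrite mulmxDr mulmxDl ![tpi (_ + _)]raddfD /= opprD addrACA.
  by apply: deg_ltD.
have := deg_ltD (IHY (T *m X)) (IHX (Y *m T)).
by rewrite !mulmxA addrA subrK.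
Qed.

(** Each maximal run of [true] gives a cycle on consecutive positions, and each [false] separates
    two cycles. *)
Fixpoint flips d i (bs : seq bool) : M d :=
  if bs is b :: bs' then (if b then flip d i i.+1 else 1%:M) *m flips d i.+1 bs'
  else 1%:M.

Lemma flipsS d i bs : flips d.+1 i.+1 bs = tcons 1%:M (flips d i bs).
Proof.
elim: bs i => [|b bs IH] i /=; first by rewrite tcons1.
by rewrite IH; case: b; rewrite ?flipS ?tconsM ?mul1mx.
Qed.

Lemma flip_alg_comm d j X a b : flip_alg d j.+1 X -> (j < a)%N -> (j < b)%N ->
  X *m flip d a b = flip d a b *m X.
Proof.
move=> + ja jb; elim=> {X} [c|i ij|X Y _ IHX _ IHY|X Y _ IHX _ IHY].
- by rewrite mul_mx_scalar mul_scalar_mx.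
- rewrite ltnS in ij; have h k : (j < k)%N -> k != i /\ k != i.+1.
    by move=> jk; split; rewrite neq_ltn orbC (leq_ltn_trans _ jk) // ltnW.
  by have [? ?] := h a ja; have [? ?] := h b jb; apply: flip_flip.
- by rewrite mulmxDl mulmxDr IHX IHY.
by rewrite -mulmxA IHY mulmxA IHX mulmxA.
Qed.

Lemma flip_alg_flips d j X i bs : flip_alg d j.+1 X -> (j < i)%N ->
  X *m flips d i bs = flips d i bs *m X.
Proof.
move=> hX; elim: bs i => [|b bs IH] i ji /=; first by rewrite mulmx1 mul1mx.
rewrite -mulmxA -IH; last exact: ltnW.
rewrite !mulmxA; congr (_ *m _); case: b; last by rewrite mulmx1 mul1mx.
by apply: flip_alg_comm hX _ _ => //; apply: ltnW.
Qed.

Lemma flip_alg_le d k l X : (k <= l)%N -> flip_alg d k X -> flip_alg d l X.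
Proof.
move=> kl; elim=> {X} [a|i ik|X Y _ hX _ hY|X Y _ hX _ hY].
- exact: flip_alg_scalar.
- by apply: flip_alg_flip; apply: leq_trans kl.
- exact: flip_algD.
- exact: flip_algM.
Qed.

Lemma flip_alg1 d X : flip_alg d 1 X -> exists a, X = a%:M.
Proof.
elim=> {X} [a|i //|X Y _ [a ->] _ [b ->]|X Y _ [a ->] _ [b ->]].
- by exists a.
- by exists (a + b); rewrite raddfD.
- by exists (a * b); rewrite scalar_mxM.
Qed.

(** The shape given by the two double cosets of S_{k+1} in S_{k+2}: the flip (k, k+1) occurs at most
    once in each summand. *)
Inductive flip_dec d k : M d -> Prop :=
| flip_dec_alg X : flip_alg d k.+1 X -> flip_dec k X
| flip_dec_flip X Y : flip_alg d k.+1 X -> flip_alg d k.+1 Y ->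
    flip_dec k (X *m flip d k k.+1 *m Y)
| flip_decD X Y : flip_dec k X -> flip_dec k Y -> flip_dec k (X + Y).

Lemma flip_dec_mul d k (X Y T : M d) : flip_alg d k.+1 X -> flip_alg d k.+1 Y ->
  flip_dec k T -> flip_dec k (X *m T *m Y).
Proof.
move=> hX hY; elim=> {T} [T hT|T T' hT hT'|T T' _ h _ h'].
- by apply: flip_dec_alg; apply: flip_algM => //; apply: flip_algM.
- have -> : X *m (T *m flip d k k.+1 *m T') *m Y = (X *m T) *m flip d k k.+1 *m (T' *m Y).
    by rewrite !mulmxA.
  by apply: flip_dec_flip; apply: flip_algM.
by rewrite mulmxDr mulmxDl; apply: flip_decD.
Qed.

Lemma flip_decM d k (T T' : M d) :
  (forall Z, flip_alg d k.+1 Z ->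
     flip_dec k (flip d k k.+1 *m Z *m flip d k k.+1)) ->
  flip_dec k T -> flip_dec k T' -> flip_dec k (T *m T').
Proof.
move=> sandwich hT hT'; elim: hT => {T} [X hX|X Y hX hY|X Y _ IHX _ IHY].
- by rewrite -[_ *m T']mulmx1; apply: flip_dec_mul => //; apply: flip_alg_scalar.
- elim: hT' => {T'} [X' hX'|X' Y' hX' hY'|X' Y' _ IHX _ IHY].
  + by rewrite -mulmxA; apply: flip_dec_flip => //; apply: flip_algM.
  + have -> : X *m flip d k k.+1 *m Y *m (X' *m flip d k k.+1 *m Y') =
        X *m (flip d k k.+1 *m (Y *m X') *m flip d k k.+1) *m Y'.
      by rewrite !mulmxA.
    by apply: flip_dec_mul => //; apply: sandwich; apply: flip_algM.
  by rewrite mulmxDr; apply: flip_decD.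
by rewrite mulmxDl; apply: flip_decD.
Qed.

(** By [flip_decM] it suffices to remove one of two copies of the last flip around an element Z of
    the smaller algebra. Decomposing Z by induction, the part without the previous flip commutes
    with the last one, which squares to 1; the other part is rewritten by the braid relation. *)
Lemma flip_alg_dec d k (T : M d) : (k.+1 < d)%N -> flip_alg d k.+2 T -> flip_dec k T.
Proof.
elim: k T => [|k IH] T kd hT.
  have sandwich Z : flip_alg d 1 Z -> flip_dec 0 (flip d 0 1 *m Z *m flip d 0 1).
    move=> /flip_alg1[a ->]; apply: flip_dec_alg.
    rewrite mul_mx_scalar -scalemxAl flipK ?scalemx1 //; last exact: ltnW.
    exact: flip_alg_scalar.
  elim: hT => {T} [a|[|i] //= _|X Y _ IHX _ IHY|X Y _ IHX _ IHY].
  - by apply/flip_dec_alg/flip_alg_scalar.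
  - rewrite -[flip _ _ _]mulmx1 -[flip _ _ _]mul1mx.
    by apply: flip_dec_flip; apply: flip_alg_scalar.
  - exact: flip_decD.
  - exact: flip_decM.
have sandwich Z : flip_alg d k.+2 Z ->
    flip_dec k.+1 (flip d k.+1 k.+2 *m Z *m flip d k.+1 k.+2).
  have PP : flip d k.+1 k.+2 *m flip d k.+1 k.+2 = 1%:M.
    by apply: flipK => //; [apply: ltn_neqS|apply: ltnW].
  have cP X : flip_alg d k.+1 X -> X *m flip d k.+1 k.+2 = flip d k.+1 k.+2 *m X.
    by move=> hX; apply: (flip_alg_comm hX); rewrite ltnS ?leqW.
  have up X : flip_alg d k.+1 X -> flip_alg d k.+2 X by apply: flip_alg_le.
  move=> hZ; have {hZ} := IH Z (ltnW kd) hZ.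
  elim=> {Z} [Z hZ|X Y hX hY|X Y _ IHX _ IHY].
  - by rewrite -cP // -mulmxA PP mulmx1; apply/flip_dec_alg/up.
  - have -> : flip d k.+1 k.+2 *m (X *m flip d k k.+1 *m Y) *m flip d k.+1 k.+2 =
        (X *m flip d k k.+1) *m flip d k.+1 k.+2 *m (flip d k k.+1 *m Y).
      rewrite !mulmxA -(cP _ hX) -[_ *m Y *m _]mulmxA (cP _ hY).
      have e : flip d k k.+1 *m flip d k.+1 k.+2 *m flip d k k.+1 =
          flip d k.+1 k.+2 *m flip d k k.+1 *m flip d k.+1 k.+2.
        have kd1 := ltnW kd; have kd0 := ltnW kd1.
        by apply: flip_braid => //; rewrite neq_ltn ltnS ?leqnn ?leqnSn.
      transitivity (X *m (flip d k k.+1 *m flip d k.+1 k.+2 *m flip d k k.+1) *m Y).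
        by rewrite e !mulmxA.
      by rewrite !mulmxA.
    have hP : flip_alg d k.+2 (flip d k k.+1) by apply: flip_alg_flip.
    by apply: flip_dec_flip; apply: flip_algM => //; apply: up.
  - by rewrite mulmxDr mulmxDl; apply: flip_decD.
elim: hT => {T} [a|i ik|X Y _ IHX _ IHY|X Y _ IHX _ IHY].
- by apply/flip_dec_alg/flip_alg_scalar.
- move: ik; rewrite ltnS leq_eqVlt => /orP[/eqP[->]|ik].
    rewrite -[flip _ _ _]mulmx1 -[flip _ _ _]mul1mx.
    by apply: flip_dec_flip; apply: flip_alg_scalar.
  by apply/flip_dec_alg/flip_alg_flip.
- exact: flip_decD.
- exact: flip_decM.
Qed.

(* \sum (-1)^{|f_1|+...+|f_k|} E_{i f_1} E_{f_1 f_2} ... E_{f_k j} *)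
Fixpoint path_sum k i j : U :=
  if k is k'.+1 then \sum_f (-1) ^+ par f *: (E i f * path_sum k' f j) else E i j.

(** * Products of cycles and sums over closed paths *)

Section Generated.
Variable S : U -> Prop.
Hypothesis S_one : S 1.
Hypothesis SL : forall a u v, S u -> S v -> S (a *: u + v).
Hypothesis SM : forall u v, S u -> S v -> S (u * v).
Hypothesis Spath : forall k, S (\sum_a path_sum k a a).

Lemma S_scale a u : S u -> S (a *: u).
Proof.
move=> Su; have S0 : S 0 by rewrite -[0](addNr 1) -scaleN1r; apply: SL.
by rewrite -[_ *: _]addr0; apply: SL.
Qed.

(* The product of the adjacent flips selected by bs is a product of cycles, which
   [tpi] turns into the corresponding product of sums over closed paths. *)
Lemma tpi_closed d (T : M d.+1) k z : S z ->
  (forall a e, tpi (op d.+1 0 (glE a e) *m T) = path_sum k a e * z) -> S (tpi T).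
Proof.
move=> Sz hT; have -> : tpi T = (\sum_a path_sum k a a) * z; last exact: SM.
rewrite mulr_suml -[T]mul1mx -(op_sum1 F m n (ltn0Sn d)) mulmx_suml raddf_sum.
by apply: eq_bigr => a _; apply: hT.
Qed.

(** The cycle through position 0 is kept open by a matrix unit there: a leading [true] lengthens the
    open path by one edge, and a leading [false] starts a new path and closes the old one into the
    factor z. *)
Lemma tpi_flips_path bs : exists k z, S z /\ forall a e,
  tpi (op (size bs).+1 0 (glE a e) *m flips (size bs).+1 0 bs) = path_sum k a e * z.
Proof.
elim: bs => [|b bs [k [z [Sz IH]]]] /=.
  exists 0%N, 1; split=> // a e; rewrite mulmx1 mulr1.
  by rewrite -[op _ _ _]mulmx1 -tcons1 tpi_cons /tpi mxE scale1r mulr1.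
rewrite flipsS; case: b; last first.
  exists 0%N, (tpi (flips (size bs).+1 0 bs)); split=> [|a e].
    exact: tpi_closed Sz IH.
  by rewrite mul1mx tpi_cons.
exists k.+1, z; split=> // a e /=.
rewrite mulmxA flipE mulmx_sumr.
have -> : \sum_c op (size bs).+2 0 (glE a e) *m (\sum_f (-1) ^+ par f *:
      (op (size bs).+2 0 (glE c f) *m op (size bs).+2 1 (glE f c))) =
    \sum_f (-1) ^+ par f *: (op (size bs).+2 0 (glE a f) *m op (size bs).+2 1 (glE f e)).
  under eq_bigr do rewrite mulmx_sumr; rewrite exchange_big; apply: eq_bigr => f _ /=.
  rewrite -(sum_delta' e (fun c => (-1) ^+ par f *:
    (op (size bs).+2 0 (glE a f) *m op (size bs).+2 1 (glE f c)))).
  apply: eq_bigr => c _; rewrite -scalemxAr mulmxA (opE_mul F (size bs).+2 0) -scalemxAl !scalerA.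
  by rewrite mulrC.
rewrite mulmx_suml raddf_sum mulr_suml; apply: eq_bigr => f _ /=.
rewrite -scalemxAl linearZ /= -scalerAl; congr (_ *: _).
have opS : op (size bs).+2 1 (glE f e) = tcons 1%:M (op (size bs).+1 0 (glE f e)) by [].
rewrite -mulmxA opS (@tconsM F m n (size bs).+1) mul1mx.
by rewrite tpi_cons IH mulrA.
Qed.

Lemma tpi_flips bs : S (tpi (flips (size bs).+1 0 bs)).
Proof. by have [k [z [Sz hz]]] := tpi_flips_path bs; apply: tpi_closed Sz hz. Qed.

Definition S_mod d (u : U) := exists y, S y /\ deg_lt d (u - y).

Lemma S_modL d a u v : S_mod d u -> S_mod d v -> S_mod d (a *: u + v).
Proof.
move=> [y [Sy hy]] [y' [Sy' hy']]; exists (a *: y + y'); split; first exact: SL.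
by rewrite opprD addrACA -scalerBr; apply: deg_ltD => //; apply: deg_ltZ.
Qed.

Lemma S_mod_trans d u v : S_mod d u -> deg_lt d (v - u) -> S_mod d v.
Proof.
move=> [y [Sy hy]] hv; exists y; split=> //.
by rewrite -[v](subrK u) -addrA; apply: deg_ltD.
Qed.

(* An element of the algebra of flips of the first j + 1 positions is reduced,
   modulo commutators, by moving everything to the left of the flip (j, j + 1). *)
Lemma tpi_flip_alg_flips d j bs (T : M d) : (j + size bs).+1 = d ->
  flip_alg d j.+1 T -> S_mod d (tpi (T *m flips d j bs)).
Proof.
elim: j bs T => [|j IH] bs T jd hT.
  have [a ->] := flip_alg1 hT; exists (a *: tpi (flips d 0 bs)).
  split; first by rewrite -jd; apply/S_scale/tpi_flips.
  by rewrite mul_scalar_mx linearZ /= subrr; apply: deg_lt0.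
have jd' : (j.+1 < d)%N by rewrite -jd addSn !ltnS leq_addr.
have jd2 b : (j + size (b :: bs)).+1 = d by rewrite -jd addnS.
elim: (flip_alg_dec jd' hT) => {hT T} [X hX|X Y hX hY|X Y _ IHX _ IHY].
- by have := IH (false :: bs) X (jd2 _) hX; rewrite /= mul1mx.
(* Y commutes with the flips to its right, and the trace property then moves it to the front, where
   it joins X. *)
- have YX : flip_alg d j.+1 (Y *m X) by apply: flip_algM.
  have := IH (true :: bs) _ (jd2 true) YX; move/S_mod_trans; apply.
  rewrite -mulmxA (flip_alg_flips bs hY (ltnSn j)) /=.
  rewrite -[Y *m X *m _]mulmxA [X *m (_ *m _)]mulmxA mulmxA.
  by apply: tpi_flip_alg; apply: flip_alg_le hY; apply: ltnW.
by rewrite mulmxDl raddfD /= -[X in X + _]scale1r; apply: S_modL.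
Qed.

Lemma tpi_flip_alg_S d (T : M d) : flip_alg d d T -> S_mod d (tpi T).
Proof.
case: d T => [|d] T hT; last first.
  by have := @tpi_flip_alg_flips d.+1 d [::] T; rewrite /= mulmx1; apply=> //; rewrite addn0.
exists (tpi T); split; first exact: S_scale S_one.
by rewrite subrr; apply: deg_lt0.
Qed.

End Generated.
End Contract.

(** * The center *)

Lemma addr5AC (V : zmodType) (a b h e f : V) : a + b - h + e - f = a + e - h + (b - f).
Proof. by rewrite [RHS]addrA; congr (_ - f); rewrite addrAC [a + b + e]addrAC addrAC. Qed.

Section Center.
Variables (F : numFieldType) (m n : nat).
Notation N := (m + n)%N.
Notation gl := (gl F m n).
Notation U := (env gl).
Notation E := (@E F m n).
Notation W := (@path_sum F m n).

Lemma supercenterP (z : U) : supercenter z <-> forall p (x : gl), hcomp p x = x ->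
  env_in x * z = iter p (@env_sigma F gl) z * env_in x.
Proof.
by split=> hz p x hx; [apply/eqP; rewrite -subr_eq0; apply/eqP; apply: hz
  |rewrite /env_ad (hz p x hx) subrr].
Qed.

Lemma supercenter1 : supercenter (1 : U).
Proof. by apply/supercenterP=> p x _; rewrite sigma_iter1 mul1r mulr1. Qed.

Lemma supercenterL a (u v : U) : supercenter u -> supercenter v ->
  supercenter (a *: u + v).
Proof.
move=> /supercenterP hu /supercenterP hv; apply/supercenterP=> p x hx.
by rewrite sigma_iterL mulrDr mulrDl -scalerAr -scalerAl (hu p) // (hv p).
Qed.

Lemma supercenterM (u v : U) : supercenter u -> supercenter v -> supercenter (u * v).
Proof.
move=> /supercenterP hu /supercenterP hv; apply/supercenterP=> p x hx.
by rewrite sigma_iterM mulrA (hu p) // -mulrA (hv p) // mulrA.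
Qed.

Lemma E_comm c d i j : E c d * E i j =
  (-1) ^+ ((par c (+) par d) && (par i (+) par j)) *: (E i j * E c d) +
  (d == i)%:R *: E c j -
  ((-1) ^+ ((par c (+) par d) && (par i (+) par j)) * (j == c)%:R) *: E i d.
Proof.
have subE (x y z : U) : x - y = z -> x = z + y by move=> <-; rewrite subrK.
have := env_in_sbr (glE_hom F c d) (glE_hom F i j).
have linZ a (x : gl) : env_in (a *: x) = a *: env_in x :> U by rewrite linearZ.
rewrite glE_sbr linearB /= !linZ scalerA => /subE h.
by rewrite [LHS]h addrC addrA.
Qed.

(** The path sums transform under the adjoint action exactly as the generators [E i j]. In the
    induction step the terms created at the intermediate index cancel. *)
Lemma path_sum_comm k c d i j : E c d * W k i j =
  (-1) ^+ ((par c (+) par d) && (par i (+) par j)) *: (W k i j * E c d) +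
  (d == i)%:R *: W k c j -
  ((-1) ^+ ((par c (+) par d) && (par i (+) par j)) * (j == c)%:R) *: W k i d.
Proof.
pose s (i j : 'I_N) : F := (-1) ^+ ((par c (+) par d) && (par i (+) par j)).
elim: k i j => [|k IH] i j; first exact: E_comm.
(* [G] and [G'] are the contributions at the intermediate index f; they survive only for f = d and f
   = c, where they coincide with opposite signs. *)
pose G f := ((-1) ^+ par f * s i f) *: (E i f * W k c j).
pose G' f := ((-1) ^+ par f * s i f) *: (E i d * W k f j).
have term f : E c d * ((-1) ^+ par f *: (E i f * W k f j)) =
    (s i j *: (((-1) ^+ par f *: (E i f * W k f j)) * E c d) +
     (d == i)%:R *: ((-1) ^+ par f *: (E c f * W k f j)) -
     (s i j * (j == c)%:R) *: ((-1) ^+ par f *: (E i f * W k f d))) +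
    ((d == f)%:R *: G f - (f == c)%:R *: G' f).
  rewrite -scalerAr mulrA E_comm -/(s i f) !(mulrDl, mulNr, =^~ scalerAl).
  rewrite -[E i f * E c d * _]mulrA IH -/(s f j) !(mulrDr, mulrN, =^~ scalerAr).
  rewrite /G /G' !(scalerDr, scalerN, scalerA) mulrA.
  have ss : s i f * s f j = s i j.
    rewrite /s -signr_addb; congr (_ ^+ _).
    by case: (par c); case: (par d); case: (par i); case: (par j); case: (par f).
  rewrite -ss.
  set A := _ * E c d; set B := E c f * _; set C := E i f * W k c j.
  set D := E i d * _; set H := E i f * W k f d.
  rewrite -[E i f * _ * E c d]mulrA -/A addr5AC.
  by congr (_ *: _ + _ *: _ - _ *: _ + (_ *: _ - _ *: _)); ring.
have GG : G d = G' c.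
  rewrite /G /G' /s -!signr_addb; congr (_ ^+ _ *: _).
  by case: (par c); case: (par d); case: (par i).
rewrite /= mulr_sumr (eq_bigr _ (fun f _ => term f)) big_split /=.
rewrite [X in _ + X]sumrB sum_delta' sum_delta GG subrr addr0.
by rewrite sumrB big_split /= -!scaler_sumr -mulr_suml.
Qed.

Lemma path_sum_central k : supercenter (\sum_a W k a a).
Proof.
apply/supercenterP=> p x hx.
have sigmaW i j : env_sigma (W k i j) = (-1) ^+ (par i (+) par j) *: W k i j.
  elim: k i j => [|k IH] i j /=; first by rewrite (env_sigma_in (glE_hom F i j)).
  rewrite raddf_sum scaler_sumr; apply: eq_bigr => f _; rewrite [LHS]linearZ /= rmorphM /= IH.
  rewrite (env_sigma_in (glE_hom F i f)) -scalerAl -scalerAr !scalerA; congr (_ *: _).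
  by case: (par i); case: (par j); case: (par f) => /=; ring.
have -> : iter p (@env_sigma F gl) (\sum_a W k a a) = \sum_a W k a a.
  case: (p) => //=; rewrite raddf_sum; apply: eq_bigr => a _.
  by rewrite /= sigmaW addbb scale1r.
elim/gl_ind: (x) => [|a y z hy hz|c d].
- by rewrite raddf0 mul0r mulr0.
- by rewrite linearP mulrDl mulrDr -scalerAl -scalerAr hy hz.
rewrite mulr_sumr mulr_suml -[env_in _]/(E c d).
under eq_bigr do rewrite path_sum_comm addbb andbF scale1r mul1r.
by rewrite sumrB big_split /= sum_delta' sum_delta addrK.
Qed.

Lemma stens_exp_path k i l : stens_exp (Ehat F m n) k.+1 i l =
  (-1) ^+ ((par i && par l) (+) par i (+) par l) *: W k i l.
Proof.
have sE (b : bool) j j' : iter b (@env_sigma F gl) (E j j') =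
    (-1) ^+ (b && (par j (+) par j')) *: E j j'.
  by case: b => /=; rewrite ?scale1r // (env_sigma_in (glE_hom _ _ _)).
elim: k i => [|k IH] i.
  rewrite /stens_exp /= mxE (bigD1 l) //= big1 => [|j nj]; last first.
    by rewrite !mxE (negPf nj) mulr0.
  by rewrite !mxE eqxx addr0 mulr1 addbb.
rewrite /stens_exp iterS -/(stens_exp _ _) mxE /= scaler_sumr.
apply: eq_bigr => j _; rewrite IH mxE.
have sZ (b : bool) a u : iter b (@env_sigma F gl) (a *: u) =
    a *: iter b (@env_sigma F gl) u by case: b => //=; rewrite linearZ.
rewrite sZ sE -!scalerAl -scalerAr !scalerA; congr (_ *: _).
by case: (par i); case: (par j); case: (par l) => /=; ring.
Qed.

Lemma Str_path k : Str (stens_exp (Ehat F m n) k.+1) = \sum_a W k a a.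
Proof.
apply: eq_bigr => a _; rewrite stens_exp_path scalerA -signr_addb.
by case: (par a); rewrite /= scale1r.
Qed.

(** * Descent on the degree of a central element *)

Section Generation.
Notation flip := (@flip F m n).
Variable S : U -> Prop.
Hypothesis S_one : S 1.
Hypothesis SL : forall a u v, S u -> S v -> S (a *: u + v).
Hypothesis SM : forall u v, S u -> S v -> S (u * v).
Hypothesis Spath : forall k, S (\sum_a W k a a).
Hypothesis S_central : forall u, S u -> supercenter u.

Lemma tpi_flip_word d k R R' T : @flip_word F m n d k R R' ->
  deg_lt d (tpi (R *m T *m R') - tpi T).
Proof.
elim=> [|i P P' _ id _ IH]; first by rewrite mul1mx mulmx1 subrr; apply: deg_lt0.
have -> : flip d i i.+1 *m P *m T *m (P' *m flip d i i.+1) =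
    flip d i i.+1 *m (P *m T *m P') *m flip d i i.+1.
  by rewrite !mulmxA.
by rewrite -[tpi _](subrK (tpi (P *m T *m P'))) -addrA; apply: deg_ltD => //; apply: tpi_flip.
Qed.

Lemma supercenter_generated d (z : U) : deg_lt d z -> supercenter z -> S z.
Proof.
elim: d z => [|d IH] z.
  by move=> /deg_lt0_eq -> _; rewrite -[0](addNr 1) -scaleN1r; apply: SL.
move=> /tpi_lead[T hT] hz.
have [L [L0 Lw Lsum]] := inj_sum_words F m n (leq0n d).
have {}Lsum s : size s = d ->
    inj_sum [set: 'I_d] s = \sum_(p <- L) p.1 *m tword d 0 s *m p.2.
  by rewrite -[size s = d]/(size s = d) -{1}[d]subn0 => /Lsum <-; congr inj_sum;
    apply/setP=> i; rewrite !inE.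
have sz0 : (size L)%:R != 0 :> F by rewrite pnatr_eq0 -lt0n.
have tau_tpi X : tau [set: 'I_d] (tpi X) = symm L X.
  elim/tword_span: X => [|a X Y hX hY|s ss hs]; first by rewrite !raddf0.
    by rewrite !linearP /= hX hY.
  by rewrite tpi_tword // tau_uword ?cardsT ?card_ord // Lsum.
have tauz : tau [set: 'I_d] z = symm L T.
  rewrite -tau_tpi -[z in LHS](subrK (tpi T)) raddfD /= (tau_deg_lt hT) ?add0r //.
  by rewrite cardsT card_ord.
have := tau_central_flip_alg L0 Lw Lsum hz; rewrite tauz.
move/(tpi_flip_alg_S S_one SL SM Spath) => [y [Sy hy]].
have sumL : \sum_(p <- L) tpi T = (size L)%:R *: tpi T.
  by rewrite big_const_seq count_predT iter_addr_0 scaler_nat.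
(* Each conjugate of T has the image of T modulo lower degree, and that image is z modulo lower
   degree. *)
have hsym : deg_lt d (tpi (symm L T) - (size L)%:R *: z).
  have -> : tpi (symm L T) - (size L)%:R *: z =
      \sum_(p <- L) (tpi (p.1 *m T *m p.2) - tpi T) - (size L)%:R *: (z - tpi T).
    by rewrite sumrB sumL /symm raddf_sum scalerBr opprB addrA subrK.
  apply: deg_ltB; last exact: deg_ltZ.
  rewrite big_seq; apply: big_ind => [||p /Lw]; [exact: deg_lt0|exact: deg_ltD|].
  exact: tpi_flip_word.
have S0 : S 0 by rewrite -[0](addNr 1) -scaleN1r; apply: SL.
have SZ a u : S u -> S (a *: u) by move=> Su; rewrite -[_ *: _]addr0; apply: SL.
(* The induction needs a central remainder; this is why [S] is required to consist of central
   elements. *)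
have Szy : S (- y + (size L)%:R *: z).
  apply: IH; first by have := deg_ltB hy hsym; rewrite opprB addrC addrA subrK addrC.
  rewrite -scaleN1r; apply: supercenterL; first exact: S_central.
  by rewrite -[_ *: z]addr0; apply: supercenterL => //; apply: S_central.
have -> : z = (size L)%:R^-1 *: (1 *: y + (- y + (size L)%:R *: z)).
  by rewrite scale1r addNKr scalerA mulVf // scale1r.
by apply: SZ; apply: SL.
Qed.

End Generation.
End Center.

From mathcomp Require Import boolp classical_sets reals complex.

Local Open Scope ring_scope.
Local Open Scope classical_set_scope.

Theorem corollary3p9 (R : realType) (m n : nat) :
  supercenter (g := gl R[i] m n) =
  smallest (subalgebra (A := env (gl R[i] m n)))
    [set Str (stens_exp (Ehat R[i] m n) k) | k in [set k : nat | (1 <= k)%N]].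
Proof.
apply/seteqP; split=> z.
  move=> hz A [[A1 AL AM] AStr].
  have [d hd] := deg_lt_exists z.
  (* A subalgebra [A] containing the generators may be larger than the center, so the descent runs
     in its intersection with the center. *)
  suff [] : A z /\ supercenter z by [].
  apply: (@supercenter_generated _ m n (fun u => A u /\ supercenter u) _ _ _ _ _ d z hd hz).
  - by split=> //; apply: supercenter1.
  - by move=> a u v [Au cu] [Av cv]; split; [apply: AL|apply: supercenterL].
  - by move=> u v [Au cu] [Av cv]; split; [apply: AM|apply: supercenterM].
  - move=> k; split; last exact: path_sum_central.
    by apply: AStr; exists k.+1 => //; apply: Str_path.
  - by move=> u [].
apply; split.
  by split; [apply: supercenter1|move=> *; apply: supercenterL|move=> *; apply: supercenterM].
by move=> _ [[//|k] _ <-]; rewrite Str_path; apply: path_sum_central.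
Qed.
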